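(* Let $k$ be a field and let $G$ be a simple graph. Suppose that $G$ contains an induced subgraph which is the disjoint union of complete bipartite graphs $K_{m_1,n_1},\dots,K_{m_s,n_s}$. Then (1) $\operatorname{reg} k[G] \ge \sum_{i=1}^s \min\{m_i,n_i\} - s$. (2) $\operatorname{pd} k[G] \ge \sum_{i=1}^s (m_i-1)(n_i-1)$.
   Context: Graphs are finite and simple (no loops, no multiple edges). A subgraph $H$ of $G$ is induced if for all vertices $x,y$ of $H$, $\{x,y\}$ is an edge of $H$ if and only if it is an edge of $G$. The complete bipartite graph $K_{u,v}$ ($u,v\ge 1$) has vertex set a disjoint union $X\sqcup Y$ with $|X|=u$, $|Y|=v$, and edges all $\{x,y\}$ with $x\in X$, $y\in Y$. For a graph $G=(V,E)$, let $k[V]$ and $k[E]$ be the polynomial rings over $k$ whose variables are the vertices, respectively the edges, of $G$. The toric ring $k[G]$ is the image of the $k$-algebra homomorphism $\phi_G: k[E]\to k[V]$ sending the variable $e=\{x,y\}\in E$ to $xy$. Via $\phi_G$, $k[G]$ is a graded module over the standard graded polynomial ring $k[E]$ (each edge variable has degree $1$). With $\beta_{i,j}(k[G])$ the graded Betti numbers of $k[G]$ over $k[E]$, $\operatorname{reg} k[G]=\max\{j-i : \beta_{i,j}(k[G])\neq 0\}$ is the Castelnuovo-Mumford regularity and $\operatorname{pd} k[G]=\max\{i : \beta_{i,j}(k[G])\ne 0 \text{ for some } j\}$ is the projective dimension over $k[E]$. *)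

(* Defs.v *)
From HB Require Import structures.
From mathcomp Require Import all_boot all_order all_algebra.
From mathcomp Require Import mpoly.
From mathcomp Require boolp.

Set Implicit Arguments.
Unset Strict Implicit.
Unset Printing Implicit Defensive.

Import GRing.Theory.
Local Open Scope ring_scope.

(** * Finite simple graphs *)

Record sgraph := SGraph {
  vertex :> finType;
  adj : rel vertex;
  adj_sym : ssrbool.symmetric adj;
  adj_irrefl : irreflexive adj }.

Definition edges (G : sgraph) : {set {set G}} :=
  [set [set p.1; p.2] | p : G * G & adj p.1 p.2].

Definition graph_iso (G H : sgraph) : Prop :=
  exists2 f : G -> H, bijective f & forall x y, adj (f x) (f y) = adj x y.

Definition induced_adj (G : sgraph) (W : {set G}) : rel {x : G | x \in W} :=
  fun x y => adj (val x) (val y).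

Lemma induced_adj_sym (G : sgraph) (W : {set G}) : ssrbool.symmetric (@induced_adj G W).
Proof. by move=> x y; apply: adj_sym. Qed.

Lemma induced_adj_irrefl (G : sgraph) (W : {set G}) :
  irreflexive (@induced_adj G W).
Proof. by move=> x; apply: adj_irrefl. Qed.

Definition induced_subgraph (G : sgraph) (W : {set G}) : sgraph :=
  SGraph (@induced_adj_sym G W) (@induced_adj_irrefl G W).

Definition biclique_adj (u v : nat) : rel ('I_u + 'I_v)%type := fun x y =>
  match x, y with
  | inl _, inr _ | inr _, inl _ => true
  | _, _ => false
  end.

Lemma biclique_adj_sym (u v : nat) : ssrbool.symmetric (@biclique_adj u v).
Proof. by case=> ? []. Qed.

Lemma biclique_adj_irrefl (u v : nat) : irreflexive (@biclique_adj u v).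
Proof. by case. Qed.

Definition complete_bipartite (u v : nat) : sgraph :=
  SGraph (@biclique_adj_sym u v) (@biclique_adj_irrefl u v).

Definition dunion_adj (I : finType) (G : I -> sgraph) :
    rel {i : I & vertex (G i)} :=
  fun x y => (tag x == tag y) && adj (tagged x) (tagged_as x y).

Lemma dunion_adj_sym (I : finType) (G : I -> sgraph) :
  ssrbool.symmetric (@dunion_adj I G).
Proof.
move=> [i x] [j y]; rewrite /dunion_adj /= eq_sym.
case: (eqVneq j i) => [ji|//]; subst j.
by rewrite !tagged_asE adj_sym.
Qed.

Lemma dunion_adj_irrefl (I : finType) (G : I -> sgraph) :
  irreflexive (@dunion_adj I G).
Proof. by move=> [i x]; rewrite /dunion_adj /= eqxx tagged_asE adj_irrefl. Qed.

Definition disjoint_union (I : finType) (G : I -> sgraph) : sgraph :=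
  SGraph (@dunion_adj_sym I G) (@dunion_adj_irrefl I G).

(** * The toric ring of a graph *)

(** The variables of [k[V]] (resp. [k[E]]) are numbered by the canonical
    enumeration of the vertices (resp. edges). *)
Notation vertex_ring k G := {mpoly k[#|vertex G|]}.
Notation edge_ring k G := {mpoly k[#|edges G|]}.

(** The variable of the edge [e = {x, y}] goes to the product of the vertices
    lying in [e], that is, to [xy]. *)
Definition toric_map (k : fieldType) (G : sgraph) (p : edge_ring k G) :
    vertex_ring k G :=
  p \mPo [tuple \prod_(x in enum_val a) 'X_(enum_rank x) | a < #|edges G|].

Lemma toric_map_is_zmod_morphism (k : fieldType) (G : sgraph) :
  zmod_morphism (@toric_map k G).
Proof. by move=> p q; rewrite /toric_map raddfB. Qed.

Lemma toric_map_is_monoid_morphism (k : fieldType) (G : sgraph) :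
  monoid_morphism (@toric_map k G).
Proof. by split=> [|p q]; rewrite /toric_map ?rmorph1 ?rmorphM. Qed.

HB.instance Definition _ (k : fieldType) (G : sgraph) :=
  GRing.isZmodMorphism.Build (edge_ring k G) (vertex_ring k G)
    (@toric_map k G) (@toric_map_is_zmod_morphism k G).
HB.instance Definition _ (k : fieldType) (G : sgraph) :=
  GRing.isMonoidMorphism.Build (edge_ring k G) (vertex_ring k G)
    (@toric_map k G) (@toric_map_is_monoid_morphism k G).

Definition toric_image (k : fieldType) (G : sgraph) : {pred vertex_ring k G} :=
  fun q => boolp.asbool (exists p : edge_ring k G, q = toric_map p).

Lemma toric_imageP (k : fieldType) (G : sgraph) (q : vertex_ring k G) :
  reflect (exists p : edge_ring k G, q = toric_map p) (q \in @toric_image k G).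
Proof. exact: boolp.asboolP. Qed.

Lemma toric_image_subring (k : fieldType) (G : sgraph) :
  subring_closed (@toric_image k G).
Proof.
split=> [|q r|q r].
- by apply/toric_imageP; exists 1; rewrite rmorph1.
- move=> /toric_imageP[p ->] /toric_imageP[p' ->].
  by apply/toric_imageP; exists (p - p'); rewrite rmorphB.
- move=> /toric_imageP[p ->] /toric_imageP[p' ->].
  by apply/toric_imageP; exists (p * p'); rewrite rmorphM.
Qed.

HB.instance Definition _ (k : fieldType) (G : sgraph) :=
  GRing.isSubringClosed.Build (vertex_ring k G) (@toric_image k G)
    (@toric_image_subring k G).

Record toric_ring (k : fieldType) (G : sgraph) := ToricRing {
  toric_val :> vertex_ring k G;
  _ : toric_val \in @toric_image k G }.

HB.instance Definition _ (k : fieldType) (G : sgraph) :=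
  [isSub for @toric_val k G].
HB.instance Definition _ (k : fieldType) (G : sgraph) :=
  [Choice of toric_ring k G by <:].
HB.instance Definition _ (k : fieldType) (G : sgraph) :=
  [SubChoice_isSubComNzRing of toric_ring k G by <:].

Lemma toric_map_image (k : fieldType) (G : sgraph) (p : edge_ring k G) :
  toric_map p \in @toric_image k G.
Proof. by apply/toric_imageP; exists p. Qed.

Definition to_toric (k : fieldType) (G : sgraph) (p : edge_ring k G) :
  toric_ring k G := ToricRing (toric_map_image p).

Definition toric_scale (k : fieldType) (G : sgraph) (p : edge_ring k G)
  (x : toric_ring k G) : toric_ring k G := to_toric p * x.

Lemma toric_scaleA (k : fieldType) (G : sgraph) (p q : edge_ring k G)
  (x : toric_ring k G) :
  toric_scale p (toric_scale q x) = toric_scale (p * q) x.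
Proof.
rewrite /toric_scale mulrA; congr (_ * _).
by apply: val_inj; rewrite /= rmorphM.
Qed.

Lemma toric_scale1 (k : fieldType) (G : sgraph) :
  left_id 1 (@toric_scale k G).
Proof.
move=> x; rewrite /toric_scale -[RHS]mul1r; congr (_ * _).
by apply: val_inj; rewrite /= rmorph1.
Qed.

Lemma toric_scaleDr (k : fieldType) (G : sgraph) :
  right_distributive (@toric_scale k G) +%R.
Proof. by move=> p x y; rewrite /toric_scale mulrDr. Qed.

Lemma toric_scaleDl (k : fieldType) (G : sgraph) (x : toric_ring k G) :
  {morph (@toric_scale k G)^~ x : p q / p + q}.
Proof.
move=> p q; rewrite /toric_scale -mulrDl; congr (_ * _).
by apply: val_inj; rewrite /= rmorphD.
Qed.

HB.instance Definition _ (k : fieldType) (G : sgraph) :=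
  GRing.Zmodule_isLmodule.Build (edge_ring k G) (toric_ring k G)
    (@toric_scaleA k G) (@toric_scale1 k G) (@toric_scaleDr k G)
    (@toric_scaleDl k G).

(** The degree [d] component of [k[G]]; in terms of [k[V]] it consists of forms
    of degree [2d]. *)
Definition toric_degree (k : fieldType) (G : sgraph) (d : nat)
    (x : toric_ring k G) : Prop :=
  exists2 p : edge_ring k G, p \is d.-homog & x = to_toric p.

(** * Minimal graded free resolutions and Betti numbers *)

(** [M] is a module over [S = k[X_1, ..., X_n]] and [Mdeg d] is the membership
    predicate of its degree [d] component, [d : nat].  The free module
    [F_i = \bigoplus_a S(- shift i a)] is represented by the row vectors of size
    [rk i], and its differential by right multiplication by a matrix.  As [M]
    lives in nonnegative degrees, so do the generators of the [F_i].  Neither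
    finite length nor minimality is built in. *)
Record free_complex (k : fieldType) (n : nat) (M : lmodType {mpoly k[n]}) :=
  FreeComplex {
    rk : nat -> nat;
    shift : forall i, 'I_(rk i) -> nat;
    aug : 'I_(rk 0) -> M;
    diff : forall i, 'M[{mpoly k[n]}]_(rk i.+1, rk i) }.

Arguments aug {k n M} f a.
Arguments shift {k n M} f {i} a.

Definition aug_map (k : fieldType) (n : nat) (M : lmodType {mpoly k[n]})
    (F : free_complex M) (v : 'rV[{mpoly k[n]}]_(rk F 0)) : M :=
  \sum_a v 0 a *: aug F a.

Arguments aug_map {k n M} F v.

(** All maps preserve degrees: the [(a, b)] entry of a differential is a form of
    degree [shift i.+1 a - shift i b], and is zero if this is negative. *)
Definition graded_complex (k : fieldType) (n : nat) (M : lmodType {mpoly k[n]})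
    (Mdeg : nat -> M -> Prop) (F : free_complex M) : Prop :=
  (forall a, Mdeg (shift F a) (aug F a)) /\
  (forall i a b, {in msupp (diff F i a b),
     forall m, (mdeg m + shift F b = shift F a)%N}).

Definition exact_complex (k : fieldType) (n : nat) (M : lmodType {mpoly k[n]})
    (F : free_complex M) : Prop :=
  [/\ forall x : M, exists v, x = aug_map F v,
      forall v, aug_map F v = 0 <-> exists w, v = w *m diff F 0
    & forall i (v : 'rV[{mpoly k[n]}]_(rk F i.+1)),
        v *m diff F i = 0 <-> exists w, v = w *m diff F i.+1].

(** The image of [F_(i+1)] lies in [(X_1, ..., X_n) F_i]. *)
Definition minimal_complex (k : fieldType) (n : nat)
    (M : lmodType {mpoly k[n]}) (F : free_complex M) : Prop :=
  forall i a b, (diff F i a b)@_0%MM = 0.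

Definition minimal_graded_free_resolution (k : fieldType) (n : nat)
    (M : lmodType {mpoly k[n]}) (Mdeg : nat -> M -> Prop)
    (F : free_complex M) : Prop :=
  [/\ graded_complex Mdeg F, exact_complex F & minimal_complex F].

Definition betti_numbers (k : fieldType) (n : nat) (M : lmodType {mpoly k[n]})
    (Mdeg : nat -> M -> Prop) (beta : nat -> nat -> nat) : Prop :=
  exists2 F : free_complex M, minimal_graded_free_resolution Mdeg F &
    forall i j, beta i j = #|[set a : 'I_(rk F i) | shift F a == j]|.

(** [is_regularity Mdeg r] says that [reg M = r], and [is_projdim Mdeg p] that
    [pd M = p]. *)
Definition is_regularity (k : fieldType) (n : nat) (M : lmodType {mpoly k[n]})
    (Mdeg : nat -> M -> Prop) (r : int) : Prop :=
  exists2 beta, betti_numbers Mdeg beta &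
    (exists i j : nat, beta i j <> 0%N /\ r = j%:Z - i%:Z) /\
    (forall i j : nat, beta i j <> 0%N -> j%:Z - i%:Z <= r).

Definition is_projdim (k : fieldType) (n : nat) (M : lmodType {mpoly k[n]})
    (Mdeg : nat -> M -> Prop) (p : nat) : Prop :=
  exists2 beta, betti_numbers Mdeg beta &
    (exists j : nat, beta p j <> 0%N) /\
    (forall i j : nat, beta i j <> 0%N -> (i <= p)%N).

(* Main.v *)
(** Writing x for the edge variables, Tor_p(k[G], k) is the Koszul homology
    H_p(x; k[G]).  A minimal resolution without a generator of degree d in
    homological degree p makes every Koszul cycle of that bidegree a boundary
    (zigzag through the Koszul complexes of the free modules, which are exact).
    So both bounds follow from one nonzero class with
    p = sum (m_i - 1)(n_i - 1) and d = p + sum (min(m_i, n_i) - 1).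

    Order the sides so that m_i <= n_i and view the edges of K_(m_i, n_i) as the
    cells of an m_i x n_i grid.  The class is the exterior product, over all
    rows but the first one of each grid, of the boundary of the simplex on the
    cells of the row, times suitable monomials.  It lives in the multidegree
    alpha giving m_i - 1 to the first row and to each column, and n_i - 1 to the
    other rows.  In this multidegree a set F of edges is a face only if its
    complement contains all the edges outside the grids and meets every row and
    every column.  The signed sum of the monotone lattice paths of the
    grids (the triangulation of a product of two simplices) has a boundary
    consisting of sets that miss a row or a column, so pairing with the
    complements of the paths kills Koszul boundaries; the only path containing
    the whole first row is the hook, so the pairing with the class is nonzero. *)
From HB Require Import structures.
Require Import Defs.
From mathcomp Require Import all_boot all_order all_algebra.
From mathcomp Require Import mpoly.
From mathcomp Require boolp.

Set Implicit Arguments.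
Unset Strict Implicit.
Unset Printing Implicit Defensive.

Import Order.TTheory GRing.Theory Num.Theory.
Local Open Scope ring_scope.

(** * Contraction and exterior multiplication *)

Section Contraction.
Variables (R : comNzRingType) (N : nat).
Implicit Types (e a : 'I_N) (F B : {set 'I_N}).

(** The Koszul sign: the cost of moving the basis vector of [e] past the elements of [F] that
    precede it. *)
Definition sgn e F : R := (-1) ^+ #|[set x in F | (x < e)%N]|.

Lemma sgnU1 e a B : a \notin B ->
  sgn e (a |: B) = (-1) ^+ (a < e)%N * sgn e B.
Proof.
move=> aB; rewrite /sgn -exprD; congr (_ ^+ _).
rewrite (cardsD1 a) !inE eqxx /=; congr addn.
by apply: eq_card => x; rewrite !inE; case: eqVneq => //= ->; rewrite (negPf aB).
Qed.

Lemma sgnK e F (x : R) : sgn e F * (sgn e F * x) = x.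
Proof. by rewrite mulrA /sgn -exprD addnn -signr_odd odd_double mul1r. Qed.

Lemma sgn_swap e a B : a != e -> a \notin B -> e \notin B ->
  sgn e B * sgn a (e |: B) = - (sgn a B * sgn e (a |: B)).
Proof.
move=> ae aB eB; rewrite !sgnU1 // [sgn e B * _]mulrCA [sgn a B * _]mulrCA.
rewrite [sgn a B * _]mulrC -mulNr; congr (_ * _).
case: (ltngtP a e) => [lt|lt|eq]; rewrite ?expr1 ?expr0 ?opprK //.
by rewrite (val_inj eq) eqxx in ae.
Qed.

Lemma sgn_swapU e a B : a != e -> a \notin B -> e \notin B ->
  sgn a (e |: B) * sgn e (a |: B) = - (sgn e B * sgn a B).
Proof.
move=> ae aB eB; rewrite !sgnU1 // mulrACA [sgn a B * _]mulrC -[RHS]mulN1r.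
congr (_ * _); case: (ltngtP a e) => [lt|lt|eq]; rewrite ?mulr1 ?mul1r //.
by rewrite (val_inj eq) eqxx in ae.
Qed.

(** The [e] positions below [e] are shared out between [B] and the complement of [e |: B], so the
    two signs multiply to [(-1) ^+ e]. *)
Lemma sgn_setC e B : e \notin B ->
  sgn e (~: (e |: B)) = (-1) ^+ e * sgn e B.
Proof.
move=> eB; rewrite -[LHS](sgnK e B) mulrC; congr (_ * _).
rewrite /sgn -exprD; congr (_ ^+ _).
rewrite -cardsUI (_ : _ :&: _ = set0) ?cards0 ?addn0; last first.
  by apply/setP => x; rewrite !inE; case: (x \in B); rewrite ?orbT ?andbF.
have inj_w : injective (widen_ord (ltnW (ltn_ord e))).
  by move=> x y /(congr1 val) /= ?; apply: val_inj.
rewrite -[RHS]card_ord -(card_imset _ inj_w).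
apply: eq_card => x; rewrite !inE; apply/idP/imsetP => [|[y _ ->]] /=.
  have [xe _|xe] := ltnP x e; last by rewrite !andbF.
  by exists (Ordinal xe) => //; apply: val_inj.
rewrite ltn_ord !andbT; have -> : widen_ord (ltnW (ltn_ord e)) y == e = false.
  by apply/negP => /eqP/(congr1 val)/= ye; have := ltn_ord y; rewrite ye ltnn.
by case: (_ \in B).
Qed.

Variable M : lmodType R.
Implicit Types (x y : {set 'I_N} -> M) (w : 'I_N -> R).

(** A function on sets is read as an element of the exterior algebra with coefficients in [M], and
    this is the contraction by the functional [w]. The variables as weights give the Koszul
    differential, the constant 1 gives the simplicial boundary, and the indicator of a block gives
    the boundary inside that block. *)
Definition contract w x F : M :=
  \sum_(e | e \notin F) (w e * sgn e F) *: x (e |: F).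

Definition wedge e x F : M :=
  if e \in F then sgn e (F :\ e) *: x (F :\ e) else 0.

Lemma eq_contract w x y : x =1 y -> contract w x =1 contract w y.
Proof. by move=> xy F; apply: eq_bigr => e _; rewrite xy. Qed.

Lemma contractDr w x y F :
  contract w (fun B => x B + y B) F = contract w x F + contract w y F.
Proof. by rewrite -big_split; apply: eq_bigr => e _; rewrite scalerDr. Qed.

Lemma contractZr w (c : R) x F :
  contract w (fun B => c *: x B) F = c *: contract w x F.
Proof.
rewrite scaler_sumr; apply: eq_bigr => e _.
by rewrite !scalerA; congr (_ *: _); rewrite mulrC.
Qed.

Lemma contractDl w w' x F :
  contract (fun e => w e + w' e) x F = contract w x F + contract w' x F.
Proof. by rewrite -big_split; apply: eq_bigr => e _; rewrite mulrDl scalerDl. Qed.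

(** Removing [a] then [e] and removing [e] then [a] carry opposite signs; the double sum is split by
    [a < e] and the halves cancel. *)
Lemma contract_sqr w x F : contract w (contract w x) F = 0.
Proof.
pose g e a : M :=
  (w e * sgn e F * (w a * sgn a (e |: F))) *: x (a |: (e |: F)).
have gC e a : a != e -> a \notin F -> e \notin F -> g e a = - g a e.
  move=> ae aF eF; rewrite /g -scaleNr setUCA; congr (_ *: _).
  by rewrite mulrACA sgn_swap // mulrN [w e * w a]mulrC mulrACA.
rewrite /contract.
under eq_bigr => e eF.
  rewrite scaler_sumr (eq_bigr (g e)); last by move=> a _; rewrite scalerA.
  rewrite (bigID (fun a : 'I_N => a < e)%N) /=.
  over.
rewrite big_split /= [X in X + _](exchange_big_dep (fun a => a \notin F)) /=; last first.
  by move=> e a eF /andP[]; rewrite !inE negb_or => /andP[].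
rewrite -big_split big1 //= => e eF; apply/eqP; rewrite addr_eq0 -sumrN; apply/eqP.
apply: eq_big => [a|a /andP[aF]].
  rewrite !inE !negb_or eF -leqNgt ltn_neqAle -!val_eqE /= eq_sym andbT.
  by case: (a \in F); case: eqP.
rewrite !inE negb_or => /andP[/andP[ea _] _].
by rewrite gC // opprK.
Qed.

(** Polarization of [contract_sqr], applied to the weight [w + w']. *)
Lemma contractC w w' x F :
  contract w (contract w' x) F = - contract w' (contract w x) F.
Proof.
have := contract_sqr (fun e => w e + w' e) x F.
rewrite (eq_contract _ (contractDl w w' x)) contractDr !contractDl.
rewrite !contract_sqr add0r addr0 addrC => /eqP.
by rewrite addr_eq0 => /eqP.
Qed.

(** The Leibniz rule. If [e] is in [F], the [e] term of the inner contraction cancels [w e *: x F];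
    otherwise only the [e] term on the left survives. *)
Lemma contract_wedge w e x F :
  contract w (wedge e x) F = w e *: x F - wedge e (contract w x) F.
Proof.
rewrite /wedge /contract; case: ifPn => eF.
- rewrite [in RHS](bigD1 e) ?setD11 //= setD1K // scalerDr scalerA mulrCA.
  rewrite -[sgn e _ * sgn e _]mulr1 -mulrA sgnK mulr1 opprD addNKr -scaleN1r.
  rewrite !scaler_sumr.
  apply: eq_big => [a|a aF].
    by rewrite !inE; case: (eqVneq a e) => [->|]; rewrite ?eF ?andbT.
  have ae : e != a by apply: contraNneq aF => <-.
  rewrite !inE eF orbT.
  have -> : (a |: F) :\ e = a |: (F :\ e).
    by apply/setP => u; rewrite !inE; case: (eqVneq u e) => // ->; rewrite (negPf ae).
  rewrite !scalerA; congr (_ *: _).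
  rewrite -{1}(setD1K eF) -mulrA sgn_swapU ?inE ?eqxx //; last 2 first.
  - by rewrite eq_sym.
  - by rewrite negb_and aF orbT.
  by rewrite mulrN mulN1r; congr (- _); rewrite mulrCA.
- rewrite subr0 (bigD1 e) //= !inE eqxx /= setU1K // scalerA -mulrA.
  rewrite -{2}[sgn e F]mulr1 sgnK mulr1 big1 ?addr0 // => a /andP[aF ae].
  by rewrite !inE eq_sym (negPf ae) (negPf eF) scaler0.
Qed.

End Contraction.

(** * Complementation of sets and the adjoint of contraction *)

Section Duality.
Variables (R : comNzRingType) (N : nat).
Implicit Types (e : 'I_N) (F H : {set 'I_N}) (x y : {set 'I_N} -> R^o).

(** This sign absorbs the factor [(-1) ^+ e] that [sgn_setC] produces when sets are replaced by
    their complements. *)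
Definition rank_sign H : R := \prod_(e in H) (-1) ^+ e.

Lemma rank_signU1 e H : e \notin H ->
  rank_sign (e |: H) = (-1) ^+ e * rank_sign H.
Proof. by move=> eH; rewrite /rank_sign big_setU1. Qed.

Lemma rank_sign_neq0 H : rank_sign H != 0.
Proof.
have s2 : rank_sign H ^+ 2 = 1.
  rewrite -prodrXl big1 // => e _.
  by rewrite -exprM mulnC exprM sqrrN !expr1n.
by apply/eqP => s0; move/eqP: s2; rewrite s0 expr0n eq_sym oner_eq0.
Qed.

(** Up to signs, contraction by the sum of all the coordinates is self-adjoint
    for the pairing of a set with its complement. *)
Lemma contract_adjoint x y :
  \sum_F rank_sign (~: F) * y (~: F) * contract (fun=> 1) x F =
  \sum_F rank_sign (~: F) * contract (fun=> 1) y (~: F) * x F.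
Proof.
rewrite /contract; under eq_bigr do rewrite mulr_sumr.
under [RHS]eq_bigr do rewrite mulr_sumr mulr_suml.
rewrite (exchange_big_dep predT) //= [RHS](exchange_big_dep predT) //=; apply: eq_bigr => e _.
rewrite (reindex_onto (fun F => F :\ e) (fun F => e |: F)) /=; last first.
  by move=> F eF; rewrite setU1K.
apply: eq_big => [F|F /andP[_ /eqP eF]].
  rewrite setD11 inE negbK /=.
  apply/eqP/idP => [<-|eF]; last by rewrite setD1K.
  by rewrite !inE eqxx.
have eF' : e \in F by rewrite -eF !inE eqxx.
have eC : e \notin ~: F by rewrite inE eF'.
have -> : ~: (F :\ e) = e |: ~: F.
  by apply/setP => a; rewrite !inE negb_and negbK.
rewrite eF rank_signU1 // !mul1r -[F :\ e]setCK.
have -> : ~: (F :\ e) = e |: ~: F.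
  by apply/setP => a; rewrite !inE negb_and negbK.
rewrite sgn_setC // /GRing.scale /= mulrACA [X in X * _ = _]mulrACA.
by rewrite -expr2 -exprM mulnC exprM sqrrN !expr1n mul1r !mulrA.
Qed.

End Duality.

(** * A product of boundaries of simplices *)

Section RowCycle.
Variables (R : comNzRingType) (N : nat) (I : eqType) (B : I -> {set 'I_N}).
Hypothesis block_disj : forall r r', r != r' -> [disjoint B r & B r'].
Implicit Types (e : 'I_N) (F U : {set 'I_N}) (rs : seq I).

Lemma in_bigcup_seq rs e :
  (e \in \bigcup_(r <- rs) B r) = has (fun r => e \in B r) rs.
Proof. by elim: rs => [|r rs IH]; rewrite ?big_nil ?big_cons ?inE //= IH. Qed.

Lemma block_inj r r' e : e \in B r -> e \in B r' -> r = r'.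
Proof.
move=> er er'; apply/eqP; apply: contraTT er' => /block_disj dis.
by rewrite (disjointFr dis).
Qed.

Lemma big_rows T (idx : T) (op : Monoid.com_law idx) rs F (f : 'I_N -> T) :
    uniq rs -> F \subset \bigcup_(r <- rs) B r ->
  \big[op/idx]_(e in F) f e =
  \big[op/idx]_(r <- rs) \big[op/idx]_(e in F | e \in B r) f e.
Proof.
move=> urs /subsetP FU; rewrite (exchange_big_dep (mem F)) /=; last first.
  by move=> r e _ /andP[].
apply: eq_bigr => e eF; move: (FU e eF); rewrite in_bigcup_seq => /hasP[r rrs er].
rewrite (eq_bigl (pred1 r)); last first.
  move=> r' /=; rewrite eF /=; apply/idP/eqP => [er'|-> //].
  exact: (block_inj er' er).
by rewrite -big_filter filter_pred1_uniq // big_seq1.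
Qed.

(** Contracting the basis vector of [U] by the indicators of the blocks in turn gives, up to sign,
    the exterior product of the boundaries of the simplices on these blocks when [U] is their union.
    In this form no sign has to be written out. *)
Definition row_cycle U rs : {set 'I_N} -> R^o :=
  foldr (fun r x => contract (fun e => (e \in B r)%:R) x)
    (fun F => (F == U)%:R) rs.

(** Each contraction removes one element of its own block. As the blocks are disjoint, [F]
    determines which element each one removed, so a coefficient has at most one nonzero term and
    nothing cancels. *)
Lemma row_cycle_neq0 U rs F : uniq rs -> {in rs, forall r, B r \subset U} ->
  row_cycle U rs F != 0 <->
  [/\ F \subset U, {in rs, forall r, #|B r :\: F| = 1%N}
    & U :\: F \subset \bigcup_(r <- rs) B r].
Proof.
elim: rs F => [|r rs IH] F /=.
  move=> _ _; rewrite big_nil subset0 setD_eq0; split=> [|[FU _ UF]].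
    by case: (eqVneq F U) => [->|_ /eqP].
  by rewrite eqEsubset FU UF oner_eq0.
move=> /andP[rrs urs] BU; have BU' : {in rs, forall r', B r' \subset U}.
  by move=> r' r'rs; apply: BU; rewrite inE r'rs orbT.
have {BU'}IH F' := IH F' urs BU'.
have Br : B r \subset U by apply: BU; rewrite mem_head.
rewrite big_cons; split=> [nz|[FU B1 UF]].
- have [e /andP[eF er] xe] : exists2 e, (e \notin F) && (e \in B r) &
      row_cycle U rs (e |: F) != 0.
    apply: boolp.contra_notP (negP nz) => /boolp.forall2NP no.
    apply/eqP; rewrite /contract big1 // => e eF.
    have [er|er] := boolP (e \in B r); last by rewrite mul0r scale0r.
    case: (no e) => [|/negP]; first by rewrite eF er.
    by rewrite negbK => /eqP ->; rewrite scaler0.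
  have [eFU B1 UF] := (IH _).1 xe.
  have uniqB r' : r' \in rs -> e \notin B r'.
    by move=> r'rs; apply: contraNN rrs => er'; rewrite (block_inj er er').
  split=> [|r'|].
  + exact: subset_trans (subsetUr _ _) eFU.
  + rewrite inE => /predU1P[{r'}->|r'rs].
      rewrite (_ : _ :\: _ = [set e]) ?cards1 //; apply/setP => a.
      rewrite !inE; apply/andP/eqP => [[aF ar]|-> //].
      (* A second element of block [r] outside [F] would have to belong to a block of [rs], which
         would then be [r] itself. *)
      apply: contraTeq rrs => ae; rewrite negbK.
      have : a \in U :\: (e |: F).
        by rewrite !inE negb_or ae aF (subsetP Br).
      move=> /(subsetP UF); rewrite in_bigcup_seq => /hasP[r' r'rs ar'].
      by rewrite (block_inj ar ar').
    rewrite -(B1 _ r'rs); apply: eq_card => a; rewrite !inE negb_or.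
    case: eqVneq => //= ->; by rewrite (negPf (uniqB _ r'rs)) andbF.
  + apply/subsetP => a; rewrite !inE => /andP[aF aU].
    have [->|ae] := eqVneq a e; first by rewrite er.
    by rewrite (subsetP UF) ?orbT // !inE negb_or ae aF.
- have /eqP/cards1P[e Be] := B1 r (mem_head _ _).
  have : e \in B r :\: F by rewrite Be set11.
  rewrite inE => /andP[eF er].
  rewrite /contract (bigD1 e) //= er mul1r big1 ?addr0; last first.
    move=> a /andP[aF ae]; rewrite (_ : a \in B r = false) ?mul0r ?scale0r //.
    apply: contraNF ae => ar; rewrite -in_set1 -Be inE aF; exact: ar.
  suff : row_cycle U rs (e |: F) != 0.
    apply: contraNneq => s0; apply/eqP.
    have {}s0 : sgn R e F * row_cycle U rs (e |: F) = 0 := s0.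
    by rewrite -[LHS](sgnK e F) s0 mulr0.
  apply/IH; split.
  + by rewrite subUset sub1set (subsetP Br) // FU.
  + move=> r' r'rs; rewrite -(B1 r'); last by rewrite inE r'rs orbT.
    apply: eq_card => a; rewrite !inE negb_or; case: eqVneq => //= ->.
    suff -> : e \in B r' = false by rewrite andbF.
    by apply: contraNF rrs => er'; rewrite (block_inj er er').
  + apply/subsetP => a; rewrite !inE negb_or -andbA => /and3P[ae aF aU].
    have := subsetP UF a; rewrite !inE aF aU => /(_ isT) /orP[ar|//].
    by move: ae; rewrite -in_set1 -Be inE aF ar.
Qed.

(** The contraction anticommutes past the other blocks until it meets its own copy, where it squares
    to zero. *)
Lemma contract_row_cycle_in U rs r F : r \in rs ->
  contract (fun e => (e \in B r)%:R) (row_cycle U rs) F = 0.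
Proof.
elim: rs F => //= r' rs IH F; rewrite inE => /predU1P[->|rrs].
  exact: contract_sqr.
rewrite contractC (eq_contract _ (y := fun=> 0)) => [|a]; last exact: IH.
by rewrite /contract big1 ?oppr0 // => e _; rewrite scaler0.
Qed.

(** Every element of the union lies in exactly one block, so on the support the weight 1 is the sum
    of the block indicators. *)
Lemma contract_row_cycle rs F : uniq rs ->
  contract (fun=> 1) (row_cycle (\bigcup_(r <- rs) B r) rs) F = 0.
Proof.
move=> urs; set U := \bigcup_(r <- rs) B r; set z := row_cycle U rs.
have BU : {in rs, forall r, B r \subset U}.
  move=> r rrs; apply/subsetP => e er.
  by rewrite in_bigcup_seq; apply/hasP; exists r.
transitivity (\sum_(r <- rs) contract (fun e => (e \in B r)%:R) z F); last first.
  by rewrite big_seq big1 // => r rrs; apply: contract_row_cycle_in.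
rewrite exchange_big /=; apply: eq_bigr => e eF.
rewrite -scaler_suml -mulr_suml.
have [zF|/(row_cycle_neq0 _ urs BU)[eFU _ _]] := eqVneq (z (e |: F)) 0.
  by rewrite zF !scaler0.
have : e \in U by rewrite (subsetP eFU) // setU11.
rewrite /U in_bigcup_seq => /hasP[r rrs er].
congr ((_ * _) *: _); rewrite (bigD1_seq r) //= er big1 ?addr0 // => r' r'r.
by rewrite (_ : e \in B r' = false) //; apply: contraNF r'r => /(block_inj er) ->.
Qed.

End RowCycle.

(** * Staircases in a grid *)

Section Staircases.
Variables (R : comNzRingType) (N : nat).
Implicit Types (H : {set 'I_N}) (x b : {set 'I_N} -> R^o).

Lemma wedge_neq0 e x H : (wedge e x H != 0) = (e \in H) && (x (H :\ e) != 0).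
Proof.
rewrite /wedge; case: ifPn => eH /=; last by rewrite eqxx.
congr (~~ _); apply/eqP/eqP => [s0|->]; last exact: scaler0.
by rewrite -[LHS](sgnK e (H :\ e)) [X in _ * X]s0 mulr0.
Qed.

Variable c : nat -> nat -> 'I_N.

(** The signed sum of the lattice paths from [(0, 0)] to [(i, j)], multiplied
    by [b]: the triangulation of a product of two simplices. *)
Fixpoint stairs b (i : nat) : nat -> {set 'I_N} -> R^o :=
  fix stairs_i j : {set 'I_N} -> R^o := wedge (c i j) (fun H =>
    (if i is i'.+1 then stairs b i' j H else if j is 0 then b H else 0) +
    (-1) ^+ i * (if j is j'.+1 then stairs_i j' H else 0)).

(** The paths to the two predecessors of the cell [(i, j)], before that cell is added. The sign
    [(-1) ^+ i] on steps along a row is what makes unit squares cancel. *)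
Definition pre_stairs b i j H : R^o :=
  (if i is i'.+1 then stairs b i' j H else if j is 0 then b H else 0) +
  (-1) ^+ i * (if j is j'.+1 then stairs b i j' H else 0).

Lemma stairsE b i j : stairs b i j = wedge (c i j) (pre_stairs b i j).
Proof. by case: i j => [|i] [|j]. Qed.

Variables (m n : nat) (b : {set 'I_N} -> R^o).
Hypothesis c_inj : forall i j i' j', (i < m)%N -> (j < n)%N -> (i' < m)%N ->
  (j' < n)%N -> c i j = c i' j' -> i = i' /\ j = j'.

Definition cells := [set c i j | i : 'I_m, j : 'I_n].

Lemma in_cells i j : (i < m)%N -> (j < n)%N -> c i j \in cells.
Proof. by move=> im jn; apply/imset2P; exists (Ordinal im) (Ordinal jn). Qed.

Hypothesis b_off : forall H, b H != 0 -> forall i j, (i < m)%N -> (j < n)%N ->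
  c i j \notin H.

Lemma setD_cells H : (forall i j, (i < m)%N -> (j < n)%N -> c i j \notin H) ->
  H :\: cells = H.
Proof.
move=> cH; apply/setP => e; rewrite inE andbC; case: (boolP (e \in H)) => //= eH.
apply/imset2P => -[i j _ _ eE]; move: eH; rewrite eE; apply/negP.
exact: cH.
Qed.

(** Necessary conditions for lying in the support, weaker than being a lattice path: the cells form
    a monotone chain inside the rectangle, and the rest is in the support of the base. *)
Record stairs_shape i j H : Prop := StairsShape {
  shape_base : b (H :\: cells) != 0;
  shape_le : forall i' j', (i' < m)%N -> (j' < n)%N -> c i' j' \in H ->
    (i' <= i)%N /\ (j' <= j)%N;
  shape_chain : forall i1 j1 i2 j2, (i1 < m)%N -> (j1 < n)%N -> (i2 < m)%N ->
    (j2 < n)%N -> c i1 j1 \in H -> c i2 j2 \in H -> (i1 < i2)%N ->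
    (j1 <= j2)%N }.

Lemma stairs_shapeW i j i' j' H : (i <= i')%N -> (j <= j')%N ->
  stairs_shape i j H -> stairs_shape i' j' H.
Proof.
move=> ii' jj' [base le chain]; split=> // i1 j1 i1m j1n h.
have [l1 l2] := le _ _ i1m j1n h.
by rewrite (leq_trans l1) // (leq_trans l2).
Qed.

Lemma base_shape i j H : b H != 0 -> stairs_shape i j H.
Proof.
move=> bH; have off := b_off bH.
split=> [|i' j' im jn|i1 j1 i2 j2 im jn _ _]; first by rewrite setD_cells.
  by rewrite (negPf (off _ _ im jn)).
by rewrite (negPf (off _ _ im jn)).
Qed.

(** The added corner is maximal in both coordinates, so it extends any monotone chain of the
    rectangle. *)
Lemma stairs_neq0_shape i j H : (i < m)%N -> (j < n)%N ->
  stairs b i j H != 0 -> stairs_shape i j H.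
Proof.
have step i' j' : (i' < m)%N -> (j' < n)%N ->
    (forall H', pre_stairs b i' j' H' != 0 -> stairs_shape i' j' H') ->
    forall H', stairs b i' j' H' != 0 -> stairs_shape i' j' H'.
  move=> im jn IH H'; rewrite stairsE wedge_neq0 => /andP[cH /IH[base le chain]].
  split.
  - move: base; rewrite (_ : _ :\: _ = H' :\: cells) //; apply/setP => e.
    rewrite !inE; case: eqVneq => //= ->; by rewrite in_cells.
  - move=> i1 j1 i1m j1n h; have [e|ne] := eqVneq (c i1 j1) (c i' j').
      by have [-> ->] := c_inj i1m j1n im jn e.
    by apply: le; rewrite // !inE ne.
  - move=> i1 j1 i2 j2 i1m j1n i2m j2n h1 h2 lt12.
    have le1 i3 j3 : (i3 < m)%N -> (j3 < n)%N -> c i3 j3 \in H' ->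
        (i3 <= i')%N /\ (j3 <= j')%N.
      move=> i3m j3n h; have [e|ne] := eqVneq (c i3 j3) (c i' j').
        by have [-> ->] := c_inj i3m j3n im jn e.
      by apply: le; rewrite // !inE ne.
    have [e|ne2] := eqVneq (c i2 j2) (c i' j').
      by have [_ ->] := c_inj i2m j2n im jn e; have [] := le1 _ _ i1m j1n h1.
    have [e|ne1] := eqVneq (c i1 j1) (c i' j').
      have [e1 _] := c_inj i1m j1n im jn e; have [] := le1 _ _ i2m j2n h2.
      by rewrite -e1 leqNgt lt12.
    by apply: (chain i1 j1 i2 j2); rewrite // !inE ?ne1 ?ne2.
elim: i j H => [|i IHi]; elim=> [|j IHj] H im jn; apply: step => // {}H.
- rewrite /pre_stairs mulr0 addr0; exact: base_shape.
- rewrite /pre_stairs add0r expr0 mul1r => nz.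
  by apply: stairs_shapeW (IHj _ im (ltnW jn) nz).
- rewrite /pre_stairs mulr0 addr0 => nz.
  by apply: stairs_shapeW (IHi _ _ (ltnW im) jn nz).
- rewrite /pre_stairs; have [->|nz _] := eqVneq (stairs b i j.+1 H) 0.
    rewrite add0r; have [->|nz _] := eqVneq (stairs b i.+1 j H) 0.
      by rewrite mulr0 eqxx.
    by apply: stairs_shapeW (IHj _ im (ltnW jn) nz).
  by apply: stairs_shapeW (IHi _ _ (ltnW im) jn nz).
Qed.

Definition row_missing i H := forall j, (j < n)%N -> c i j \notin H.
Definition col_missing j H := forall i, (i < m)%N -> c i j \notin H.

Lemma shape_row_missing i i' j H : (i < i' < m)%N ->
  stairs_shape i j H -> row_missing i' H.
Proof.
move=> /andP[ii' im] [_ le _] j' jn; apply/negP => h.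
by have [] := le _ _ im jn h; rewrite leqNgt ii'.
Qed.

Lemma shape_col_missing i j j' H : (j < j' < n)%N ->
  stairs_shape i j H -> col_missing j' H.
Proof.
move=> /andP[jj' jn] [_ le _] i' im; apply/negP => h.
by have [_] := le _ _ im jn h; rewrite leqNgt jj'.
Qed.

Variable Q : {set 'I_N} -> Prop.
Hypothesis Q_add : forall i j H, (i < m)%N -> (j < n)%N -> Q H ->
  Q (c i j |: H).
Hypothesis contract_b : forall H, contract (fun=> 1) b H != 0 -> Q H.

(** The inequalities are strict because the paths in [pre_stairs] stop before the corner [(i, j)]:
    some of them never meet row [i], others never meet column [j]. *)
Definition degenerate i j H :=
  [\/ exists2 i', (i' < i)%N & row_missing i' H,
      exists2 j', (j' < j)%N & col_missing j' H
    | Q H].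

Lemma degenerateW i j i' j' H : (i <= i')%N -> (j <= j')%N ->
  degenerate i j H -> degenerate i' j' H.
Proof.
move=> ii' jj' [[i1 lt1 h]|[j1 lt1 h]|q].
- by apply: Or31; exists i1 => //; apply: leq_trans ii'.
- by apply: Or32; exists j1 => //; apply: leq_trans jj'.
- exact: Or33.
Qed.

Lemma degenerate_add i j H : (i < m)%N -> (j < n)%N -> c i j \in H ->
  degenerate i j (H :\ c i j) -> degenerate i j H.
Proof.
move=> im jn cH [[i1 lt1 h]|[j1 lt1 h]|q].
- apply: Or31; exists i1 => // j' jn'; have := h j' jn'.
  rewrite !inE; case: eqVneq => //= e.
  have [e1 _] := c_inj (ltn_trans lt1 im) jn' im jn e.
  by rewrite e1 ltnn in lt1.
- apply: Or32; exists j1 => // i' im'; have := h i' im'.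
  rewrite !inE; case: eqVneq => //= e.
  have [_ e1] := c_inj im' (ltn_trans lt1 jn) im jn e.
  by rewrite e1 ltnn in lt1.
- by apply: Or33; rewrite -(setD1K cH); apply: Q_add.
Qed.

Lemma contract_stairs i j H : contract (fun=> 1) (stairs b i j) H =
  pre_stairs b i j H - wedge (c i j) (contract (fun=> 1) (pre_stairs b i j)) H.
Proof. by rewrite stairsE contract_wedge scale1r. Qed.

(** A path coming from the previous row has no cell in row [i]; for [i = 0] the base has no cells at
    all. *)
Lemma pre_stairs_row0 i j H : (i < m)%N -> (j < n)%N -> ~ row_missing i H ->
  (if i is i'.+1 then stairs b i' j H else if j is 0 then b H else 0) = 0.
Proof.
move=> im jn; apply: boolp.contra_notP => /eqP.
case: i im => [|i] im; last first.
  by move/(stairs_neq0_shape (ltnW im) jn)/shape_row_missing; apply; rewrite ltnSn.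
by case: j jn => [|j] jn; rewrite ?eqxx // => /b_off off j' jn'; apply: off.
Qed.

Lemma pre_stairs_col0 i j H : (i < m)%N -> (j < n)%N -> ~ col_missing j H ->
  (if j is j'.+1 then stairs b i j' H else 0) = 0.
Proof.
move=> im jn; apply: boolp.contra_notP => /eqP.
case: j jn => [|j] jn; rewrite ?eqxx //.
by move/(stairs_neq0_shape im (ltnW jn))/shape_col_missing; apply; rewrite ltnSn.
Qed.

(** The two ways of going around a unit square of the grid cancel. *)
Lemma contract_pre_stairs i j H : (i < m)%N -> (j < n)%N ->
  contract (fun=> 1) (pre_stairs b i j) H != 0 -> degenerate i j H.
Proof.
move=> im jn; apply: boolp.contra_neqP.
(* The correction term of the Leibniz rule vanishes by induction, since adding back a corner cannot
   repair a missing earlier row or column. *)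
have wedge0 i' j' H' : (i' < m)%N -> (j' < n)%N ->
    (forall H'', ~ degenerate i' j' H'' ->
       contract (fun=> 1) (pre_stairs b i' j') H'' = 0) ->
    ~ degenerate i' j' H' ->
    wedge (c i' j') (contract (fun=> 1) (pre_stairs b i' j')) H' = 0.
  move=> im' jn' IH nd; apply/eqP; apply: boolp.contra_notT nd.
  rewrite wedge_neq0 => /andP[cH nz]; apply: degenerate_add => //.
  exact: (boolp.contra_neqP (IH _) nz).
elim: i j H im jn => [|i IHi]; elim=> [|j IHj] H im jn nd.
- rewrite (eq_contract _ (y := b)) => [|F]; last first.
    by rewrite /pre_stairs mulr0 addr0.
  by apply/eqP; apply: boolp.contra_notT nd => /contract_b; apply: Or33.
- have nc : ~ col_missing j H by move=> h; apply: nd; apply: Or32; exists j.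
  rewrite (eq_contract _ (y := stairs b 0 j)) => [|F]; last first.
    by rewrite /pre_stairs add0r expr0 mul1r.
  rewrite contract_stairs wedge0 ?(ltnW jn) //; last first.
  + by move=> d; apply: nd; apply: degenerateW d.
  + by move=> H'; apply: IHj; rewrite ?(ltnW jn).
  rewrite subr0 /pre_stairs pre_stairs_col0 ?(ltnW jn) // mulr0 addr0.
  case: j {IHj nd} jn nc => // jn nc; apply/eqP; apply: boolp.contra_notT nc.
  by move=> /b_off off i' im'; apply: off; rewrite // ltnW.
- have nr : ~ row_missing i H by move=> h; apply: nd; apply: Or31; exists i.
  rewrite (eq_contract _ (y := stairs b i 0)) => [|F]; last first.
    by rewrite /pre_stairs mulr0 addr0.
  rewrite contract_stairs wedge0 ?(ltnW im) //; last first.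
  + by move=> d; apply: nd; apply: degenerateW d.
  + by move=> H'; apply: IHi; rewrite ?(ltnW im).
  by rewrite subr0 /pre_stairs pre_stairs_row0 ?(ltnW im) // mulr0 addr0.
- have nc : ~ col_missing j H by move=> h; apply: nd; apply: Or32; exists j.
  have nr : ~ row_missing i H by move=> h; apply: nd; apply: Or31; exists i.
  rewrite /pre_stairs contractDr contractZr !contract_stairs.
  rewrite !wedge0 ?(ltnW im) ?(ltnW jn) //; first last.
  + by move=> d; apply: nd; apply: degenerateW d.
  + by move=> H'; apply: IHi; rewrite ?(ltnW im).
  + by move=> d; apply: nd; apply: degenerateW d.
  + by move=> H'; apply: IHj; rewrite ?(ltnW jn).
  (* Since [H] meets row [i] and column [j], both remaining sums reduce to the paths through
     [(i, j)], with signs [(-1) ^+ i] and [(-1) ^+ i.+1]. *)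
  rewrite !subr0 /pre_stairs pre_stairs_row0 ?(ltnW im) //.
  rewrite pre_stairs_col0 ?(ltnW jn) // mulr0 addr0 add0r exprS mulN1r.
  by rewrite scaleNr subrr.
Qed.

(** In the Leibniz rule at the last corner, the wedge term is supported on degenerate sets, and the
    other term consists of paths deprived of that corner, which miss the last row or the last
    column. *)
Lemma contract_stairs_neq0 H : (0 < m)%N -> (0 < n)%N ->
    contract (fun=> 1) (stairs b m.-1 n.-1) H != 0 ->
  [\/ exists2 i, (i < m)%N & row_missing i H,
      exists2 j, (j < n)%N & col_missing j H | Q H].
Proof.
move=> m_gt0 n_gt0; rewrite contract_stairs.
have im : (m.-1 < m)%N by rewrite prednK.
have jn : (n.-1 < n)%N by rewrite prednK.
apply: boolp.contra_neqP => nd.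
have /eqP -> : wedge (c m.-1 n.-1)
    (contract (fun=> 1) (pre_stairs b m.-1 n.-1)) H == 0.
  apply: boolp.contra_notT nd; rewrite wedge_neq0 => /andP[cH].
  move=> /(contract_pre_stairs im jn)/(degenerate_add im jn cH).
  case=> [[i lti h]|[j ltj h]|q]; [apply: Or31|apply: Or32|exact: Or33].
    by exists i => //; apply: ltn_trans im.
  by exists j => //; apply: ltn_trans jn.
rewrite subr0 /pre_stairs pre_stairs_row0 // ?pre_stairs_col0 ?mulr0 ?addr0 //.
- by move=> h; apply: nd; apply: Or32; exists n.-1.
- by move=> h; apply: nd; apply: Or31; exists m.-1.
Qed.

(** The hook is the path along row 0 and then down the last column. Its cells are peeled off from
    the end; at each corner only one predecessor contributes, so nothing cancels. *)
Lemma stairs_hook H : (0 < m)%N -> (0 < n)%N -> b (H :\: cells) != 0 ->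
    (forall i j, (i < m)%N -> (j < n)%N ->
      (c i j \in H) = (i == 0%N) || (j == n.-1)) ->
  stairs b m.-1 n.-1 H != 0.
Proof.
move=> m_gt0 n_gt0 bH cH.
have setD1_cells i j F : (i < m)%N -> (j < n)%N ->
    (F :\ c i j) :\: cells = F :\: cells.
  move=> im jn; apply/setP => e; rewrite !inE.
  by case: eqVneq => //= ->; rewrite in_cells.
have in_setD1 i j i' j' F : (i < m)%N -> (j < n)%N -> (i' < m)%N -> (j' < n)%N ->
    (c i' j' \in F :\ c i j) = ~~ ((i' == i) && (j' == j)) && (c i' j' \in F).
  move=> im jn im' jn'; rewrite !inE; congr (~~ _ && _).
  apply/eqP/andP => [e|[/eqP -> /eqP -> //]].
  by have [-> ->] := c_inj im' jn' im jn e.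
have row j F : (j < n)%N -> b (F :\: cells) != 0 ->
    (forall i j', (i < m)%N -> (j' < n)%N ->
      (c i j' \in F) = (i == 0%N) && (j' <= j)%N) ->
    stairs b 0 j F != 0.
  elim: j F => [|j IH] F jn bF cF; rewrite stairsE wedge_neq0 cF // leqnn /=;
    rewrite /pre_stairs ?mulr0 ?addr0 ?add0r ?expr0 ?mul1r.
    move: bF; rewrite -(setD1_cells 0%N 0%N) // setD_cells // => i j im jn'.
    by rewrite in_setD1 // cF // leqn0; case: eqP => //=; case: eqP.
  apply: IH; rewrite ?setD1_cells ?(ltnW jn) // => i j' im jn'.
  rewrite in_setD1 // cF //; case: eqP => //= _.
  by rewrite -[RHS]ltnS [RHS]ltn_neqAle.
have jn : (n.-1 < n)%N by rewrite prednK.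
suff col i F : (i < m)%N -> b (F :\: cells) != 0 ->
    (forall i' j, (i' < m)%N -> (j < n)%N ->
      (c i' j \in F) = (i' == 0%N) || ((i' <= i)%N && (j == n.-1))) ->
    stairs b i n.-1 F != 0.
  apply: col => // [|i j im jn']; first by rewrite prednK.
  by rewrite cH // -ltnS prednK // im.
elim: i F => [|i IH] F im bF cF.
  apply: row => // i j im' jn'; rewrite cF // leqn0.
  by rewrite -ltnS prednK // jn' andbT; case: eqP.
rewrite stairsE wedge_neq0 cF // leqnn eqxx /= /pre_stairs.
(* A path arriving along the row would avoid the last column, but the cell [(0, n.-1)] is
   present. *)
set y := (X in _ + _ * X); have -> : y = 0.
  apply: pre_stairs_col0 => // /(_ 0%N m_gt0).
  by rewrite in_setD1 // cF.
rewrite mulr0 addr0; apply: IH; rewrite ?setD1_cells ?(ltnW im) // => i' j im' jn'.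
rewrite in_setD1 // cF //; case: eqP => [->|] /=.
  by rewrite ltnn; case: eqP => //= _; rewrite andbF.
by move=> /eqP ne; rewrite [(i' <= i.+1)%N]leq_eqVlt (negPf ne) ltnS.
Qed.

End Staircases.

(** * Products of staircases over several grids *)

Section StairsProduct.
Variables (R : comNzRingType) (N : nat) (T : eqType) (m n : T -> nat).
Variable c : T -> nat -> nat -> 'I_N.
Hypotheses (m_gt0 : forall t, (0 < m t)%N) (n_gt0 : forall t, (0 < n t)%N).
Hypothesis c_inj : forall t i j t' i' j', (i < m t)%N -> (j < n t)%N ->
  (i' < m t')%N -> (j' < n t')%N -> c t i j = c t' i' j' ->
  [/\ t = t', i = i' & j = j'].
Variable E0 : {set 'I_N}.
Hypothesis c_notin_E0 : forall t i j, (i < m t)%N -> (j < n t)%N ->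
  c t i j \notin E0.
Implicit Types (H : {set 'I_N}) (ts : seq T).

Local Notation C t := (cells (c t) (m t) (n t)).

(** Using one staircase sum as the base of the next multiplies them; the innermost base is the
    indicator of [E0]. *)
Definition stairs_product ts : {set 'I_N} -> R^o :=
  foldr (fun t b => stairs (c t) b (m t).-1 (n t).-1)
    (fun H => (H == E0)%:R) ts.

Lemma m_pred t : ((m t).-1 < m t)%N. Proof. by rewrite prednK. Qed.
Lemma n_pred t : ((n t).-1 < n t)%N. Proof. by rewrite prednK. Qed.

Lemma c_injt t i j i' j' : (i < m t)%N -> (j < n t)%N -> (i' < m t)%N ->
  (j' < n t)%N -> c t i j = c t i' j' -> i = i' /\ j = j'.
Proof. by move=> im jn im' jn' /(c_inj im jn im' jn')[]. Qed.

Lemma in_setD_cells t t' i j H : t' != t -> (i < m t')%N -> (j < n t')%N ->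
  (c t' i j \in H :\: C t) = (c t' i j \in H).
Proof.
move=> t't im jn; rewrite inE.
suff /negPf -> : c t' i j \notin C t by [].
apply/imset2P => -[i' j' _ _ e].
by have [tt' _ _] := c_inj im jn (ltn_ord i') (ltn_ord j') e; rewrite tt' eqxx in t't.
Qed.

Lemma stairs_product_off ts H : uniq ts -> stairs_product ts H != 0 ->
  forall t i j, t \notin ts -> (i < m t)%N -> (j < n t)%N -> c t i j \notin H.
Proof.
elim: ts H => [|t ts IH] H /=.
  move=> _; have [-> _ t i j _|_] := eqVneq H E0; last by rewrite eqxx.
  exact: c_notin_E0.
move=> /andP[tts uts] nz t' i j; rewrite inE negb_or => /andP[t't t'ts] im jn.
have [base _ _] := stairs_neq0_shape (c_injt (t := t))
  (fun H nzH i j => IH H uts nzH t i j tts) (m_pred t) (n_pred t) nz.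
by rewrite -(in_setD_cells _ t't) //; apply: IH uts base _ _ _ _ _ _.
Qed.

Lemma stairs_product_shape t ts H : uniq (t :: ts) ->
  stairs_product (t :: ts) H != 0 ->
  stairs_shape (c t) (m t) (n t) (stairs_product ts) (m t).-1 (n t).-1 H.
Proof.
move=> /andP[tts uts] nz; apply: stairs_neq0_shape (m_pred t) (n_pred t) nz.
  exact: c_injt.
by move=> H' nz' i j; apply: stairs_product_off nz' _ _ _ _.
Qed.

Lemma stairs_product_chain ts H t i1 j1 i2 j2 :
    uniq ts -> stairs_product ts H != 0 -> t \in ts ->
    (i1 < m t)%N -> (j1 < n t)%N -> (i2 < m t)%N -> (j2 < n t)%N ->
  c t i1 j1 \in H -> c t i2 j2 \in H -> (i1 < i2)%N -> (j1 <= j2)%N.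
Proof.
elim: ts H => // t' ts IH H uts nz; have [base _ chain] := stairs_product_shape uts nz.
have /andP[tts uts'] := uts; rewrite inE; have [-> _|tt' /= t_ts] := eqVneq t t'.
  exact: chain.
move=> i1m j1n i2m j2n.
rewrite -(in_setD_cells H tt' i1m j1n) -(in_setD_cells H tt' i2m j2n).
exact: IH.
Qed.

Definition unsupported ts H :=
  (exists2 e, e \in E0 & e \notin H) \/
  exists2 t, t \in ts &
    (exists2 i, (i < m t)%N & row_missing (c t) (n t) i H) \/
    (exists2 j, (j < n t)%N & col_missing (c t) (m t) j H).

(** Induction on the grids: in the one-grid lemma, the predicate [Q] is [unsupported] for the grids
    already treated. With no grid, [H] is [E0] with one element removed. *)
Lemma contract_stairs_product ts H : uniq ts ->
  contract (fun=> 1) (stairs_product ts) H != 0 -> unsupported ts H.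
Proof.
elim: ts H => [|t ts IH] H.
  move=> _ nz; left; apply: boolp.contra_neqP nz => no.
  rewrite /contract big1 // => e eH /=.
  case: eqVneq => [eE0|_]; last by rewrite scaler0.
  by case: no; exists e; rewrite // -eE0 setU11.
move=> uts nz; have /andP[tts uts'] := uts.
have Q_add i j H' : (i < m t)%N -> (j < n t)%N -> unsupported ts H' ->
    unsupported ts (c t i j |: H').
  move=> im jn [[e eE0 eH]|[t' t'ts rc]]; [left|right].
    exists e => //; rewrite !inE negb_or eH andbT.
    by apply: contraTneq eE0 => ->; apply: c_notin_E0.
  have add i' j' : (i' < m t')%N -> (j' < n t')%N -> c t' i' j' \notin H' ->
      c t' i' j' \notin c t i j |: H'.
    move=> im' jn' h; rewrite !inE negb_or h andbT.
    apply: contraNneq tts => e; have [<- _ _] := c_inj im' jn' im jn e.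
    exact: t'ts.
  exists t' => //; case: rc => -[i' lt h]; [left|right]; exists i' => // j' lt'.
    exact: add (h j' lt').
  exact: add (h j' lt').
have := contract_stairs_neq0 (c_injt (t := t))
  (fun H nzH i j => stairs_product_off uts' nzH tts) Q_add
  (fun H => IH H uts') (m_gt0 t) (n_gt0 t) nz.
case=> [row|col|[e|[t' t'ts h]]].
- by right; exists t; rewrite ?mem_head //; left.
- by right; exists t; rewrite ?mem_head //; right.
- by left.
- by right; exists t' => //; rewrite inE t'ts orbT.
Qed.

Lemma stairs_product_hook ts H : uniq ts ->
    (forall e, (forall t i j, (i < m t)%N -> (j < n t)%N -> e != c t i j) ->
      (e \in H) = (e \in E0)) ->
    (forall t i j, (i < m t)%N -> (j < n t)%N ->
      (c t i j \in H) = (t \in ts) && ((i == 0%N) || (j == (n t).-1))) ->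
  stairs_product ts H != 0.
Proof.
elim: ts H => [|t ts IH] H uts HE0 cH.
  rewrite /= (_ : H = E0) ?eqxx ?oner_eq0 //; apply/setP => e.
  have [[t [i [j [im jn ->]]]]|no] := boolp.EM (exists t i j,
      [/\ (i < m t)%N, (j < n t)%N & e = c t i j]).
    by rewrite cH // (negPf (c_notin_E0 im jn)).
  apply: HE0 => t i j im jn; apply/eqP => eE; apply: no.
  by exists t, i, j.
have /andP[tts uts'] := uts.
have cHt i j : (i < m t)%N -> (j < n t)%N ->
    (c t i j \in H) = (i == 0%N) || (j == (n t).-1).
  by move=> im jn; rewrite cH // mem_head.
apply: (stairs_hook (c_injt (t := t)) _ (m_gt0 t) (n_gt0 t) _ cHt).
  by move=> H' nz i j; apply: stairs_product_off nz _ _ _ tts.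
apply: IH => // [e no|t' i j im jn].
  rewrite -HE0 // inE; suff -> : e \notin C t by [].
  by apply/imset2P => -[i j _ _]; apply/eqP; apply: no.
have [e|t't] := eqVneq t' t.
  by rewrite e in im jn *; rewrite inE (negPf tts) in_cells.
by rewrite in_setD_cells // cH // inE (negPf t't).
Qed.

End StairsProduct.

(** * The row cycle pairs nontrivially with the staircase cocycle *)

Section Pairing.
Variables (k : fieldType) (N : nat) (T : finType) (m n : T -> nat).
Variable c : T -> nat -> nat -> 'I_N.
Hypotheses (m_gt0 : forall t, (0 < m t)%N) (n_gt0 : forall t, (0 < n t)%N).
Hypothesis c_inj : forall t i j t' i' j', (i < m t)%N -> (j < n t)%N ->
  (i' < m t')%N -> (j' < n t')%N -> c t i j = c t' i' j' ->
  [/\ t = t', i = i' & j = j'].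
Implicit Types (e : 'I_N) (F H : {set 'I_N}).

(** Rows out of range are empty, so that distinct rows are disjoint without side conditions. *)
Definition grid_row (r : T * nat) : {set 'I_N} :=
  if (r.2 < m r.1)%N then [set c r.1 r.2 j | j : 'I_(n r.1)] else set0.

Definition rows : seq (T * nat) :=
  [seq (t, i) | t <- enum T, i <- iota 1 (m t).-1].

Definition non_cells : {set 'I_N} :=
  [set e | [forall t, forall i : 'I_(m t), forall j : 'I_(n t), e != c t i j]].

Lemma grid_rowP t i e : reflect
  (exists2 j, (i < m t)%N /\ (j < n t)%N & e = c t i j) (e \in grid_row (t, i)).
Proof.
rewrite /grid_row /=; case: ifPn => im; last first.
  by rewrite inE; constructor => -[j []].
apply: (iffP imsetP) => [[j _ ->]|[j [_ jn] ->]]; first by exists j.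
by exists (Ordinal jn).
Qed.

Lemma in_grid_row t i j : (i < m t)%N -> (j < n t)%N -> c t i j \in grid_row (t, i).
Proof. by move=> im jn; apply/grid_rowP; exists j. Qed.

Lemma card_grid_row t i : (i < m t)%N -> #|grid_row (t, i)| = n t.
Proof.
move=> im; rewrite /grid_row /= im card_imset ?card_ord // => j j' e.
by have [_ _] := c_inj im (ltn_ord j) im (ltn_ord j') e; apply: val_inj.
Qed.

Lemma grid_row_disj r r' : r != r' -> [disjoint grid_row r & grid_row r'].
Proof.
case: r r' => [t i] [t' i'] rr'; rewrite -setI_eq0; apply/eqP/setP => e.
rewrite !inE; apply: contraNF rr' => /andP[].
move=> /grid_rowP[j [im jn] ->] /grid_rowP[j' [im' jn'] e'].
by have [-> -> _] := c_inj im jn im' jn' e'.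
Qed.

Lemma mem_rows t i : ((t, i) \in rows) = (0 < i < m t)%N.
Proof.
apply/allpairsPdep/idP => [[t' [i' [_ h [-> ->]]]]|h].
  by move: h; rewrite mem_iota add1n prednK.
by exists t, i; rewrite mem_enum mem_iota add1n prednK.
Qed.

Lemma rows_uniq : uniq rows.
Proof.
apply: allpairs_uniq_dep => [|t _|[t i] [t' i'] _ _ /= [-> ->] //].
  exact: enum_uniq.
exact: iota_uniq.
Qed.

Lemma in_non_cells e : reflect
  (forall t i j, (i < m t)%N -> (j < n t)%N -> e != c t i j) (e \in non_cells).
Proof.
rewrite inE; apply: (iffP forallP) => [h t i j im jn|h t].
  by have /forallP/(_ (Ordinal im))/forallP/(_ (Ordinal jn)) := h t.
by apply/forallP => i; apply/forallP => j; apply: h.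
Qed.

Lemma cell_notin_non_cells t i j : (i < m t)%N -> (j < n t)%N ->
  c t i j \notin non_cells.
Proof.
by move=> im jn; apply/negP => /in_non_cells/(_ t i j im jn); rewrite eqxx.
Qed.

Lemma cellP e : e \notin non_cells ->
  exists t i j, [/\ (i < m t)%N, (j < n t)%N & e = c t i j].
Proof.
move=> /negP ne; apply: boolp.contrapT => no; apply: ne.
apply/in_non_cells => t i j im jn; apply/eqP => eE.
by apply: no; exists t, i, j.
Qed.

Local Notation U := (\bigcup_(r <- rows) grid_row r).
Definition grid_cycle : {set 'I_N} -> k^o := row_cycle k grid_row U rows.
Definition grid_cocycle : {set 'I_N} -> k^o :=
  stairs_product k m n c non_cells (enum T).

Lemma in_rows_union t i j : (i < m t)%N -> (j < n t)%N ->
  (c t i j \in U) = (0 < i)%N.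
Proof.
move=> im jn; rewrite in_bigcup_seq; apply/hasP/idP => [[[t' i'] h]|i_gt0].
  rewrite mem_rows in h; move=> /grid_rowP[j' [im' jn'] e].
  by have [_ -> _] := c_inj im jn im' jn' e; case/andP: h.
by exists (t, i); rewrite ?mem_rows ?i_gt0 // in_grid_row.
Qed.

Lemma rows_union_cells e : e \in U -> e \notin non_cells.
Proof.
rewrite in_bigcup_seq => /hasP[[t i] _ /grid_rowP[j [im jn] ->]].
exact: cell_notin_non_cells.
Qed.

Lemma grid_cycle_neq0 F : grid_cycle F != 0 <->
  F \subset U /\ {in rows, forall r, #|grid_row r :\: F| = 1%N}.
Proof.
have BU : {in rows, forall r, grid_row r \subset U}.
  move=> r rr; apply/subsetP => e er.
  by rewrite in_bigcup_seq; apply/hasP; exists r.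
split=> [/(row_cycle_neq0 k grid_row_disj F rows_uniq BU)[? ? _]|[FU B1]] //.
apply/(row_cycle_neq0 k grid_row_disj F rows_uniq BU); split=> //.
exact: subsetDl.
Qed.

(** The supports share only [F0], whose complement consists of the non-cells and the hooks. For [F]
    in the support of the cycle, the complement contains all of row 0 and one cell of every other
    row, and monotonicity puts that cell in the last column. *)
Lemma grid_pairing_neq0 :
  \sum_F rank_sign k (~: F) * grid_cocycle (~: F) * grid_cycle F != 0.
Proof.
pose F0 := [set e | [exists t, exists i : 'I_(m t), exists j : 'I_(n t),
  [&& 0 < i, j < (n t).-1 & e == c t i j]%N]].
have cF0 t i j : (i < m t)%N -> (j < n t)%N ->
    (c t i j \in F0) = (0 < i)%N && (j < (n t).-1)%N.
  move=> im jn; rewrite inE; apply/existsP/andP => [[t']|[i0 j0]].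
    case/existsP=> i' /existsP[j' /and3P[i0 j0 /eqP e]].
    have [tt' -> ->] := c_inj im jn (ltn_ord i') (ltn_ord j') e.
    by rewrite tt'.
  exists t; apply/existsP; exists (Ordinal im); apply/existsP.
  by exists (Ordinal jn); rewrite /= i0 j0 eqxx.
have F0cell e : e \in non_cells -> e \notin F0.
  move=> /in_non_cells ne; rewrite inE; apply/existsP => -[t].
  case/existsP=> i /existsP[j /and3P[_ _]].
  by rewrite (negPf (ne _ _ _ (ltn_ord i) (ltn_ord j))).
have n_pred t : ((n t).-1 < n t)%N by rewrite prednK.
have F0E F : grid_cycle F != 0 -> grid_cocycle (~: F) != 0 -> F = F0.
  move=> /grid_cycle_neq0[FU B1] yF.
  (* The comparison is with the cell [(0, (n t).-1)], which the complement of [F] contains. *)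
  have sparse t i j : (0 < i < m t)%N -> (j < n t)%N -> c t i j \notin F ->
      j = (n t).-1.
    move=> /andP[i0 im] jn ijF; apply/eqP; rewrite eqn_leq -ltnS prednK // jn /=.
    apply: (stairs_product_chain m_gt0 n_gt0 c_inj cell_notin_non_cells
      (enum_uniq T) yF (mem_enum _ t) (m_gt0 t) (n_pred t) im jn _ _ i0).
      rewrite inE; apply: contraFN (in_rows_union (m_gt0 t) (n_pred t)).
      exact: (subsetP FU).
    by rewrite inE.
  apply/setP => e; have [ne|/cellP[t [i [j [im jn ->]]]]] := boolP (e \in non_cells).
    rewrite (negPf (F0cell e ne)); apply: contraTF ne.
    by move=> /(subsetP FU)/rows_union_cells.
  rewrite cF0 //; have [i0|i0] := posnP i.
    have cU : c t i j \in U = false by rewrite in_rows_union // i0.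
    by apply: contraFF cU; apply: (subsetP FU).
  have im0 : (0 < i < m t)%N by rewrite i0.
  have [jl|jl] /= := ltnP j (n t).-1.
    apply: contraTT jl => /(sparse t i j im0 jn) ->; by rewrite ltnn.
  have je : j = (n t).-1 by apply/eqP; rewrite eqn_leq jl -ltnS prednK // jn.
  have /eqP/cards1P[e' Be'] : #|grid_row (t, i) :\: F| = 1%N.
    by apply: B1; rewrite mem_rows.
  have : e' \in grid_row (t, i) :\: F by rewrite Be' set11.
  rewrite inE => /andP[e'F /grid_rowP[j' [_ jn'] eE]].
  rewrite eE in e'F; have := sparse t i j' im0 jn' e'F.
  by move=> j'E; rewrite je -j'E (negPf e'F).
rewrite (bigD1 F0) //= big1 => [|F FF0]; last first.
  have [->|zF] := eqVneq (grid_cycle F) 0; first by rewrite mulr0.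
  have [->|yF] := eqVneq (grid_cocycle (~: F)) 0; first by rewrite mulr0 mul0r.
  by rewrite (F0E F zF yF) eqxx in FF0.
rewrite addr0 !mulf_neq0 ?rank_sign_neq0 //.
  apply: (stairs_product_hook k m_gt0 n_gt0 c_inj cell_notin_non_cells) => //.
  - exact: enum_uniq.
  - move=> e /in_non_cells ne; rewrite ne inE; exact: F0cell.
  - move=> t i j im jn; rewrite inE cF0 // mem_enum /= negb_and -eqn0Ngt.
    by rewrite ltn_neqAle -[(j <= _)%N]ltnS prednK // jn andbT negbK.
apply/grid_cycle_neq0; split=> [|[t i]].
  apply/subsetP => e eF0; have : e \notin non_cells.
    by apply: contraTN eF0; apply: F0cell.
  move=> /cellP[t [i [j [im jn eE]]]]; move: eF0; rewrite eE cF0 // in_rows_union //.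
  by case/andP.
rewrite mem_rows => /andP[i0 im].
rewrite (_ : _ :\: _ = [set c t i (n t).-1]) ?cards1 //; apply/setP => e.
rewrite in_setD in_set1; apply/andP/eqP => [[eF0 /grid_rowP[j [_ jn] eE]]|->].
  move: eF0; rewrite eE cF0 // i0 /= -leqNgt => jl; congr (c _ _ _).
  by apply/eqP; rewrite eqn_leq jl -ltnS prednK // jn.
by rewrite cF0 // ltnn andbF in_grid_row.
Qed.

End Pairing.

(** * Exactness of the Koszul complex of the variables *)

Section Koszul.
Variables (k : fieldType) (N : nat).
Local Notation S := {mpoly k[N]}.
Implicit Types (e a : 'I_N) (F B : {set 'I_N}) (p : S) (mu : 'X_{1..N}).

Local Notation koszul := (contract (fun e => 'X_e : S)).

Lemma sgn_mpolyC e F : sgn S e F = (sgn k e F)%:MP.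
Proof. by rewrite /sgn rmorphXn /= mpolyCN mpolyC1. Qed.

Lemma mcoeffXUM e p mu :
  ('X_e * p)@_mu = if mu e == 0%N then 0 else p@_(mu - U_(e))%MM.
Proof.
rewrite mulrC; case: ifPn => [/eqP mu0|mu0].
  rewrite mcoeffM big1 // => -[k1 k2] /= /eqP muE; rewrite mcoeffX.
  case: eqVneq => [e2|_]; last by rewrite mulr0.
  by move/mnmP/(_ e): muE; rewrite mu0 mnmDE -e2 mnm1E eqxx addn1.
have {1}-> : mu = (U_(e) + (mu - U_(e)))%MM by rewrite addmC submK // lep1mP.
by rewrite mcoeffMX.
Qed.

Lemma mcoeff_koszul (u : {set 'I_N} -> S^o) F mu :
  (koszul u F : S)@_mu =
  \sum_(e | (e \notin F) && (mu e != 0%N)) sgn k e F * (u (e |: F) : S)@_(mu - U_(e))%MM.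
Proof.
rewrite raddf_sum /= big_mkcondr; apply: eq_bigr => e eF.
rewrite [_ *: _](_ : _ = (sgn k e F)%:MP * ('X_e * u (e |: F))); last first.
  by rewrite -sgn_mpolyC mulrA [sgn S e F * _]mulrC.
by rewrite mcoeffCM mcoeffXUM; case: eqP => //= _; rewrite mulr0.
Qed.

(** Division by [X_a], keeping only the quotient monomials in [P]; it realizes as a polynomial the
    cone operator, which is prescribed coefficientwise. *)
Lemma mpoly_shift p (P : pred 'X_{1..N}) a : exists q : S,
  forall mu, q@_mu = if P mu then p@_(mu + U_(a))%MM else 0.
Proof.
exists (\sum_(m <- msupp p | (m a != 0%N) && P (m - U_(a))%MM)
  p@_m *: 'X_[m - U_(a)]) => mu.
rewrite raddf_sum /=; under eq_bigr do rewrite mcoeffZ mcoeffX.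
have shiftE (m : 'X_{1..N}) : m a != 0%N -> ((m - U_(a))%MM == mu) = (m == (mu + U_(a))%MM).
  move=> ma; apply/eqP/eqP => [<-|->]; last by rewrite addmK.
  by rewrite submK // lep1mP.
have [pmu|pmu] := boolP ((mu + U_(a))%MM \in msupp p); last first.
  rewrite (memN_msupp_eq0 pmu) if_same big_seq_cond big1 // => m /and3P[mp ma _].
  rewrite shiftE //; case: eqVneq => [mE|_]; last by rewrite mulr0.
  by rewrite -mE mp in pmu.
rewrite big_mkcond (bigD1_seq _ pmu) ?msupp_uniq //= addmK mnmDE mnm1E eqxx addn1 /=.
rewrite eqxx mulr1 big1 ?addr0 // => m mE; case: ifP => // /andP[ma _].
by rewrite shiftE // (negPf mE) mulr0.
Qed.

(** The multidegree of the basis vector of [F]: a coefficient [mu] at [F] sits in multidegree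
    [mu + mset F], which the Koszul differential preserves. *)
Definition mset F : 'X_{1..N} := [multinom (e \in F : nat) | e < N].

Lemma mset_setU1 e F mu : e \notin F -> mu e != 0%N ->
  (mu - U_(e) + mset (e |: F) = mu + mset F)%MM.
Proof.
move=> eF mue; apply/mnmP => a; rewrite !mnmDE mnmBE mnm1E !mnmE !inE.
case: (eqVneq e a) => [<-|_]; last by rewrite subn0.
by rewrite (negPf eF) addn0 subnK // lt0n.
Qed.

(** In each multidegree the complex is the augmented chain complex of a simplex;
    a cone with apex a variable of that multidegree contracts it. *)
Lemma koszul_exact (u : {set 'I_N} -> S^o) :
    (forall F, koszul u F = 0) -> (u set0 : S)@_0%MM = 0 ->
  exists v : {set 'I_N} -> S^o, forall F, u F = koszul v F.
Proof.
(* The apex is read off the multidegree alone, so it is common to all terms that the differential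
   connects. *)
move=> cyc u0; pose apex mu := [pick a | mu a != 0%N].
have [q qE] : exists q : {set 'I_N} * 'I_N -> S, forall Fa mu, (q Fa)@_mu =
    if apex (mu + mset Fa.1)%MM == Some Fa.2
    then (u (Fa.1 :\ Fa.2) : S)@_(mu + U_(Fa.2))%MM else 0.
  have /boolp.choice[q qE] := fun Fa : {set 'I_N} * 'I_N =>
    mpoly_shift (u (Fa.1 :\ Fa.2)) (fun mu => apex (mu + mset Fa.1)%MM == Some Fa.2) Fa.2.
  by exists q.
exists (fun F => \sum_(a in F) sgn S a (F :\ a) * q (F, a)) => F.
set v := (X in koszul X).
have vE F' mu : (v F' : S)@_mu = if apex (mu + mset F')%MM is Some a then
    if a \in F' then sgn k a (F' :\ a) * (u (F' :\ a) : S)@_(mu + U_(a))%MM else 0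
    else 0.
  rewrite /v raddf_sum /=.
  under eq_bigr do rewrite sgn_mpolyC mcoeffCM qE /=.
  case: (apex _) => [a|]; last by rewrite big1 // => a _; rewrite mulr0.
  case: ifPn => aF.
    rewrite (bigD1 a) //= eqxx big1 ?addr0 // => e /andP[_ ea].
    by rewrite ifN ?mulr0 // (inj_eq Some_inj) eq_sym.
  rewrite big1 // => e eF; rewrite ifN ?mulr0 // (inj_eq Some_inj).
  by apply: contraNneq aF => ->.
apply/mpolyP => mu; rewrite mcoeff_koszul.
rewrite (eq_bigr (fun e => sgn k e F * if apex (mu + mset F)%MM is Some a then
    if a \in e |: F then sgn k a ((e |: F) :\ a) *
      (u ((e |: F) :\ a) : S)@_(mu - U_(e) + U_(a))%MM else 0 else 0));
  last by move=> e /andP[eF mue]; rewrite vE mset_setU1.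
(* No apex means multidegree zero, that is, the constant term at the empty set, where [u0]
   applies. *)
rewrite /apex; case: pickP => [a|no]; last first.
  rewrite big_pred0 => [|e]; last first.
    by have := no e; rewrite mnmDE; case: (mu e) => //=; rewrite andbF.
  have -> : mu = 0%MM.
    by apply/mnmP => e; have := no e; rewrite mnmDE mnm0E; case: (mu e).
  suff -> : F = set0 by [].
  apply/setP => e; rewrite inE; have := no e; rewrite mnmDE mnmE addn_eq0 negb_and.
  by case: (e \in F); rewrite ?orbT.
rewrite mnmDE mnmE => gamma_a; have [aF|aF] := boolP (a \in F); last first.
  have mua : mu a != 0%N by move: gamma_a; rewrite (negPf aF) addn0.
  rewrite (bigD1 a) /= ?aF // setU11 setU1K // sgnK submK ?lep1mP //.
  rewrite big1 ?addr0 // => e /andP[_ ea].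
  by rewrite !inE (negPf aF) orbF eq_sym (negPf ea) mulr0.
(* When the apex lies in [F], the cycle equation at [F :\ a] is solved for [u F]; the other terms
   are those of the cone. *)
have aB : a \notin F :\ a by rewrite !inE eqxx.
have := congr1 (mcoeff (mu + U_(a))%MM) (cyc (F :\ a)).
rewrite mcoeff_koszul mcoeff0 (bigD1 a) /=; last first.
  by rewrite aB mnmDE mnm1E eqxx addn1.
rewrite setD1K // addmK => /eqP; rewrite addr_eq0 => /eqP uE.
rewrite -[LHS](sgnK a (F :\ a)) uE mulrN mulr_sumr -sumrN.
apply: eq_big => [e|e].
  rewrite !inE mnmDE mnm1E; case: (eqVneq e a) => [->|_]; rewrite ?aF ?andbF //=.
  by rewrite addn0 andbT.
rewrite -andbA => /and3P[eB mue ea]; rewrite !inE aF orbT.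
have eaF : (e |: F) :\ a = e |: (F :\ a).
  by apply/setP => x; rewrite !inE; case: eqVneq => //= ->; rewrite eq_sym (negPf ea).
rewrite eaF -{4}(setD1K aF) mulrA [sgn k e _ * _]mulrC (sgn_swapU _ ea) //.
rewrite mnmDE mnm1E [a == e]eq_sym (negPf ea) addn0 in mue.
rewrite [(mu - _ + _)%MM]addmC addmBA ?lep1mP // [(U_(a) + _)%MM]addmC.
by rewrite mulNr [X in - (_ * X)]mulrC mulrA.
Qed.

End Koszul.

(** * Koszul homology and generators of a minimal resolution *)

Section MpolyFilter.
Variables (k : fieldType) (N : nat).
Implicit Types (p r : {mpoly k[N]}) (P : pred 'X_{1..N}).

Definition mpoly_filter P p : {mpoly k[N]} :=
  \sum_(m <- msupp p | P m) p@_m *: 'X_[m].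

Lemma mcoeff_filter P p m : (mpoly_filter P p)@_m = if P m then p@_m else 0.
Proof.
rewrite raddf_sum /=; under eq_bigr do rewrite mcoeffZ mcoeffX.
have [pm|pm] := boolP (m \in msupp p); last first.
  rewrite (memN_msupp_eq0 pm) if_same big_seq_cond big1 // => m' /andP[pm' _].
  by case: eqVneq => [e|_]; rewrite ?mulr0 // -e pm' in pm *.
rewrite big_mkcond (bigD1_seq _ pm) ?msupp_uniq //= eqxx mulr1 big1 ?addr0 //.
by move=> m' /negPf ->; rewrite mulr0 if_same.
Qed.

(** Used with [r] a form and [P], [P'] degree conditions: multiplication by a form shifts degrees by
    a constant, so it commutes with taking homogeneous parts. *)
Lemma mcoeff_filterM P P' p r m :
    (forall m1 m2, m2 \in msupp r -> P m1 = P' (m1 + m2)%MM) ->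
  (mpoly_filter P p * r)@_m = if P' m then (p * r)@_m else 0.
Proof.
move=> PP'; rewrite !mcoeffM (_ : (if _ then _ else _) =
    \sum_(k0 : 'X_{1..N < (mdeg m).+1, (mdeg m).+1} | m == (k0.1 + k0.2)%MM)
      if P' m then p@_k0.1 * r@_k0.2 else 0); last first.
  by case: ifP => // _; rewrite big1.
apply: eq_bigr => -[m1 m2] /= /eqP mE; rewrite mcoeff_filter.
have [rm2|rm2] := boolP (val m2 \in msupp r); last first.
  by rewrite (memN_msupp_eq0 rm2) !mulr0 if_same.
by rewrite (PP' _ _ rm2) -mE; case: ifP; rewrite ?mul0r.
Qed.

End MpolyFilter.

Lemma contract_linear (R : comNzRingType) (N : nat) (M M' : lmodType R)
    (f : {linear M -> M'}) (w : 'I_N -> R) (x : {set 'I_N} -> M) F :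
  f (contract w x F) = contract w (fun B => f (x B)) F.
Proof. by rewrite linear_sum; apply: eq_bigr => e _; rewrite linearZ. Qed.

Lemma aug_map_is_linear (k : fieldType) (N : nat) (M : lmodType {mpoly k[N]})
  (K : free_complex M) : linear (aug_map K).
Proof.
move=> c u v; rewrite /aug_map scaler_sumr -big_split.
by apply: eq_bigr => a _; rewrite !mxE scalerDl scalerA.
Qed.

HB.instance Definition _ (k : fieldType) (N : nat) (M : lmodType {mpoly k[N]})
    (K : free_complex M) :=
  GRing.isLinear.Build _ _ _ _ (aug_map K) (@aug_map_is_linear k N M K).

(** * The zigzag between a minimal resolution and the Koszul complex *)

Section Balancing.
Variables (k : fieldType) (N : nat) (M : lmodType {mpoly k[N]}).
Variables (Mdeg : nat -> M -> Prop) (K : free_complex M).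
Hypothesis K_res : minimal_graded_free_resolution Mdeg K.
Local Notation S := {mpoly k[N]}.
Local Notation koszul := (contract (fun e => 'X_e : S)).
Implicit Types (F : {set 'I_N}).

Lemma koszul_exact_row r (u : {set 'I_N} -> 'rV[S]_r) :
    (forall F, koszul u F = 0) -> (forall a, (u set0 0 a)@_0%MM = 0) ->
  exists v : {set 'I_N} -> 'rV[S]_r, forall F, u F = koszul v F.
Proof.
move=> cyc u0.
have entry (x : {set 'I_N} -> 'rV[S]_r) a F :
    (koszul x F) 0 a = koszul (fun B => x B 0 a : S^o) F.
  by rewrite summxE; apply: eq_bigr => e _; rewrite mxE.
have ex a : exists v : {set 'I_N} -> S^o, forall F, u F 0 a = koszul v F.
  by apply: koszul_exact => // F; rewrite -entry cyc mxE.
have [v vE] := boolp.choice ex.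
exists (fun F => \row_a v a F) => F; apply/rowP => a; rewrite entry vE.
by apply: eq_bigr => e _; rewrite mxE.
Qed.

(** Elements of exterior degree [q] over the [i]-th free module, of internal degree [d], where each
    exterior generator has degree 1. *)
Definition homog_chain i d q (w : {set 'I_N} -> 'rV[S]_(rk K i)) :=
  forall F a m, m \in msupp (w F 0 a) ->
    #|F| = q /\ (mdeg m + shift K a + q = d)%N.

Lemma homog_chain_card i d q w F : @homog_chain i d q w -> #|F| != q -> w F = 0.
Proof.
move=> hw Fq; apply/rowP => a; rewrite mxE; apply/mpolyP => m; rewrite mcoeff0.
by apply/memN_msupp_eq0/negP => /hw[/eqP]; rewrite (negPf Fq).
Qed.

Lemma homog_koszul i d q w : @homog_chain i d q.+1 w -> homog_chain d q (koszul w).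
Proof.
move=> hw F a m; rewrite mcoeff_msupp summxE.
rewrite (_ : (\sum_(_ | _) _) = koszul (fun B => w B 0 a : S^o) F); last first.
  by apply: eq_bigr => e _; rewrite mxE.
rewrite mcoeff_koszul => nz.
have [e /andP[eF me] we] : exists2 e, (e \notin F) && (m e != 0%N) &
    (w (e |: F) 0 a)@_(m - U_(e))%MM != 0.
  apply: boolp.contra_notP (negP nz) => /boolp.forall2NP no.
  rewrite big1 // => e eP; case: (no e) => // /negP.
  by rewrite negbK => /eqP ->; rewrite mulr0.
rewrite -mcoeff_msupp in we; have [] := hw _ _ _ we.
rewrite cardsU1 eF add1n => -[Fq]; split=> //.
rewrite -(@submK _ U_(e)%MM m) ?lep1mP // mdegD mdeg1 -b.
by rewrite addn1 addSn addnS.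
Qed.

(** The entries of the differential are forms, so any lift can be replaced by its component of the
    right degree. *)
Lemma homog_lift i d q w : @homog_chain i d q w ->
    (forall F, exists v, w F = v *m diff K i) ->
  exists2 w', @homog_chain i.+1 d q w' & forall F, w F = w' F *m diff K i.
Proof.
have [[_ diff_deg] _ _] := K_res.
move=> hw /boolp.choice[v vE].
pose P a (m : 'X_{1..N}) := (mdeg m + shift K a + q == d)%N.
exists (fun F => if #|F| == q then \row_a mpoly_filter (P i.+1 a) (v F 0 a) else 0).
  move=> F a m; rewrite mcoeff_msupp; case: ifP => [/eqP Fq|_]; last first.
    by rewrite mxE mcoeff0 eqxx.
  rewrite mxE mcoeff_filter; case: ifP => [/eqP //|_]; by rewrite eqxx.
move=> F; case: ifPn => Fq; last by rewrite mul0mx (homog_chain_card hw).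
apply/rowP => b; apply/mpolyP => m; rewrite mxE raddf_sum /=.
have -> : (w F 0 b)@_m = if P i b m then (w F 0 b)@_m else 0.
  case: ifPn => // nP; apply/memN_msupp_eq0; apply: contra nP => /hw[_ e].
  by rewrite /P e.
rewrite vE [in LHS]mxE [in LHS]raddf_sum /=.
transitivity (\sum_a if P i b m then (v F 0 a * diff K i a b)@_m else 0).
  by case: ifP => // _; rewrite big1.
apply: eq_bigr => a _; rewrite mxE; symmetry; apply: mcoeff_filterM.
move=> m1 m2 /diff_deg degE; congr (_ == _).
by rewrite mdegD -degE addnA.
Qed.

(** Each zigzag step trades one exterior degree for one homological degree: the Koszul image of [w]
    is lifted along [diff], the lift is split by induction, and its Koszul part corrects [w] to a
    Koszul cycle. The process ends in homological degree [p]. *)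
Lemma homog_chain_split p d : (forall a : 'I_(rk K p), shift K a != d) ->
  forall q i w, (i + q)%N = p -> @homog_chain i d q w ->
    ((0 < q)%N -> forall F, exists w', koszul w F = w' *m diff K i) ->
  exists u v, forall F, w F = u F *m diff K i + koszul v F.
Proof.
have [_ [_ _ exK] minK] := K_res.
move=> no_d; elim=> [|q IH] i w.
  rewrite addn0 => ip; subst i => hw _.
  have [|a|v vE] := @koszul_exact_row _ w.
  - move=> F; rewrite /contract big1 // => e eF.
    by rewrite (homog_chain_card hw) ?scaler0 // cardsU1 eF.
  (* At [q = 0] a constant term would require a generator of degree exactly [d]. *)
  - apply/memN_msupp_eq0/negP => /hw[_].
    by rewrite mdeg0 add0n addn0 => /eqP; apply/negP.
  by exists (fun=> 0), v => F; rewrite mul0mx add0r.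
move=> iq hw /(_ isT) w_lift.
have [w' hw' w'E] := homog_lift (homog_koszul hw) w_lift.
have mul_koszul j (x : {set 'I_N} -> 'rV[S]_(rk K j.+1)) F :
    koszul x F *m diff K j = koszul (fun B => x B *m diff K j) F.
  exact: (contract_linear (mulmxr (diff K j))).
have [||u [v uvE]] := IH i.+1 w' _ hw'.
- by rewrite addSnnS.
- move=> _ F; apply/exK; rewrite mul_koszul (eq_contract _ (y := koszul w)) //.
  exact: contract_sqr.
have [|a|v' v'E] := @koszul_exact_row _ (fun F => w F - v F *m diff K i).
- move=> F; rewrite contractDr.
  rewrite (eq_contract (x := fun B => - (v B *m diff K i)) _
    (y := fun B => -1 *: (v B *m diff K i))); last by move=> B; rewrite scaleN1r.
  rewrite contractZr scaleN1r -mul_koszul w'E uvE mulmxDl.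
  rewrite (_ : u F *m diff K i.+1 *m diff K i = 0) ?add0r ?subrr //.
  by apply/exK; exists (u F).
(* At the empty set [w] vanishes because its exterior degree is positive, and minimality removes the
   constant term of the correction. *)
- rewrite (homog_chain_card hw) ?cards0 // sub0r !mxE mcoeffN raddf_sum /= big1 ?oppr0 //.
  move=> b _; rewrite mcoeffM big1 // => -[m1 m2] /= /eqP/esym/eqP.
  rewrite mnmD_eq0 => /andP[_ /eqP ->]; by rewrite minK mulr0.
by exists v, v' => F; rewrite -v'E addrC subrK.
Qed.

Theorem koszul_cycle_boundary p d w : (forall a : 'I_(rk K p), shift K a != d) ->
    @homog_chain 0 d p w -> (forall F, aug_map K (koszul w F) = 0) ->
  exists u, forall F, aug_map K (w F) = koszul u F.
Proof.
have [_ [_ exK _] _] := K_res.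
move=> no_d hw cyc.
have [||u [v uvE]] := homog_chain_split no_d _ hw => //.
  by move=> _ F; apply/exK.
exists (fun F => aug_map K (v F)) => F; rewrite uvE raddfD /=.
rewrite (_ : aug_map K (u F *m diff K 0) = 0) ?add0r; last first.
  by apply/exK; exists (u F).
exact: contract_linear.
Qed.

End Balancing.

(** * The toric ring *)

Lemma mpolyX_sum (R : nzRingType) n I (r : seq I) (P : pred I)
    (f : I -> 'X_{1..n}) :
  'X_[\big[mnm_add/0%MM]_(i <- r | P i) f i] =
    \prod_(i <- r | P i) 'X_[f i] :> {mpoly R[n]}.
Proof.
by apply: (big_morph (fun m => 'X_[m])); [exact: mpolyXD | exact: mpolyX0].
Qed.

Section Toric.
Variables (k : fieldType) (G : sgraph).
Local Notation N := #|edges G|.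
Implicit Types (e : 'I_N) (F : {set 'I_N}) (p : edge_ring k G).

Definition edge_mnm e : 'X_{1..#|G|} :=
  [multinom (enum_val v \in enum_val e : nat) | v < #|G|].

Definition edge_expo (m : 'X_{1..N}) : 'X_{1..#|G|} :=
  (\sum_e edge_mnm e *+ m e)%MM.

Lemma edge_mnmE e : (\sum_(x in enum_val e) U_(enum_rank x))%MM = edge_mnm e.
Proof.
apply/mnmP => v; rewrite mnm_sumE mnmE; have [ve|ve] := boolP (_ \in _).
  rewrite (bigD1 (enum_val v)) //= enum_valK mnm1E eqxx big1 // => x /andP[_ xv].
  by rewrite mnm1E -(inj_eq enum_val_inj) enum_rankK (negPf xv).
rewrite big1 // => x xe; rewrite mnm1E; apply/eqP; rewrite eqb0.
by apply: contraNneq ve => <-; rewrite enum_rankK.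
Qed.

Lemma toric_mapXU e : toric_map ('X_e : edge_ring k G) = 'X_[edge_mnm e].
Proof.
rewrite /toric_map comp_mpolyXU -tnth_nth tnth_mktuple -edge_mnmE.
by rewrite mpolyX_sum.
Qed.

Lemma toric_mapX m : toric_map ('X_[m] : edge_ring k G) = 'X_[edge_expo m].
Proof.
rewrite /toric_map comp_mpolyX /edge_expo mpolyX_sum; apply: eq_bigr => e _.
by rewrite -mpolyXn -toric_mapXU /toric_map comp_mpolyXU -tnth_nth.
Qed.

Lemma toric_mapZ (a : k) p : toric_map (a *: p) = a *: toric_map p.
Proof. exact: comp_mpolyZ. Qed.

Lemma toric_mapE p :
  toric_map p = \sum_(m <- msupp p) p@_m *: 'X_[edge_expo m].
Proof.
rewrite {1}(mpolyE p) raddf_sum; apply: eq_bigr => m _.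
by rewrite /= toric_mapZ toric_mapX.
Qed.

Lemma mdeg_edge_mnm e : mdeg (edge_mnm e) = 2%N.
Proof.
rewrite -edge_mnmE mdeg_sum (eq_bigr (fun=> 1%N)) => [|x _]; last exact: mdeg1.
rewrite sum1_card; have /imsetP[[x y] xy ->] := enum_valP e.
rewrite cards2; case: eqVneq xy => //= <-; by rewrite inE /= adj_irrefl.
Qed.

Lemma mdeg_edge_expo m : mdeg (edge_expo m) = (mdeg m).*2.
Proof.
rewrite /edge_expo mdeg_sum mdegE -muln2 big_distrl; apply: eq_bigr => e _.
by rewrite mdegMn mdeg_edge_mnm mulnC.
Qed.

Lemma edge_expo0 : edge_expo 0 = 0%MM.
Proof.
apply/mnmP => v; rewrite mnm_sumE mnm0E big1 // => e _.
by rewrite mulmnE mnm0E muln0.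
Qed.

Lemma edge_expoD m1 m2 : edge_expo (m1 + m2) = (edge_expo m1 + edge_expo m2)%MM.
Proof.
apply/mnmP => v; rewrite mnmDE !mnm_sumE -big_split; apply: eq_bigr => e _.
by rewrite /= !mulmnE mnmDE mulnDr.
Qed.

Lemma edge_expoU e : edge_expo U_(e) = edge_mnm e.
Proof.
rewrite /edge_expo (bigD1 e) //= mnm1E eqxx mulm1n big1 ?addm0 // => a ae.
by rewrite mnm1E eq_sym (negPf ae).
Qed.

(** The toric map doubles the degree of every monomial, so different degrees cannot cancel and its
    kernel is homogeneous. *)
Lemma toric_map_filter0 d p : toric_map p = 0 ->
  toric_map (mpoly_filter (fun m => mdeg m == d) p) = 0.
Proof.
move=> p0; rewrite raddf_sum /=; apply/mpolyP => mu; rewrite mcoeff0.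
have := congr1 (mcoeff mu) p0; rewrite mcoeff0 toric_mapE !raddf_sum /=.
have termE m : (toric_map (p@_m *: 'X_[m]))@_mu =
    (p@_m *: 'X_[edge_expo m] : vertex_ring k G)@_mu.
  by rewrite toric_mapZ toric_mapX.
under [X in _ -> X = _]eq_bigr do rewrite termE.
have [mud|mud] := boolP (mdeg mu == d.*2).
  rewrite [in X in X -> _](bigID (fun m => mdeg m == d)) /=.
  rewrite [X in _ + X](_ : _ = 0) ?addr0 // big1 // => m md.
  rewrite mcoeffZ mcoeffX; case: eqVneq => [mE|_]; last by rewrite mulr0.
  by rewrite -mE mdeg_edge_expo (inj_eq double_inj) (negPf md) in mud.
move=> _; rewrite big1 // => m /eqP md; rewrite mcoeffZ mcoeffX.
case: eqVneq => [mE|_]; last by rewrite mulr0.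
by rewrite -mE mdeg_edge_expo md eqxx in mud.
Qed.

Lemma toric_val_sum I (r : seq I) (P : pred I) (f : I -> toric_ring k G) :
  toric_val (\sum_(i <- r | P i) f i) = \sum_(i <- r | P i) toric_val (f i).
Proof. by apply: (big_morph (@toric_val k G)). Qed.

Lemma toric_valZ p (x : toric_ring k G) :
  toric_val (p *: x) = toric_map p * toric_val x.
Proof. by []. Qed.

(** An arbitrary lift is cut down to degree [d]; the image does not change because the generators
    map to homogeneous elements and the toric kernel is homogeneous. *)
Lemma toric_lift (K : free_complex (toric_ring k G)) d x :
    minimal_graded_free_resolution (@toric_degree k G) K -> toric_degree d x ->
  exists2 v, aug_map K v = x &
    forall a m, m \in msupp (v 0 a) -> (mdeg m + shift K a = d)%N.
Proof.
move=> [[aug_deg _] [aug_surj _ _] _] [q qd xE].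
have [v vE] := aug_surj x.
have /boolp.choice[g gE] : forall a, exists g : edge_ring k G,
    g \is (shift K a).-homog /\ aug K a = to_toric g.
  by move=> a; have [g ? ?] := aug_deg a; exists g.
have augE u : toric_val (aug_map K u) = toric_map (\sum_a u 0 a * g a).
  rewrite toric_val_sum raddf_sum; apply: eq_bigr => a _.
  by rewrite toric_valZ (gE a).2; apply/esym/rmorphM.
pose v' := \row_a mpoly_filter (fun m => mdeg m + shift K a == d)%N (v 0 a).
exists v' => [|a m]; last first.
  by rewrite mcoeff_msupp mxE mcoeff_filter; case: ifP => [/eqP //|]; rewrite eqxx.
apply: val_inj; rewrite /= augE.
rewrite (_ : \sum_a _ = mpoly_filter (fun m => mdeg m == d) (\sum_a v 0 a * g a)); last first.
  apply/mpolyP => m; rewrite mcoeff_filter !raddf_sum /=.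
  transitivity (\sum_a if mdeg m == d then (v 0 a * g a)@_m else 0).
    apply: eq_bigr => a _; rewrite mxE; apply: (mcoeff_filterM (P' := fun m => mdeg m == d)) => m1 m2.
    by have /dhomogP ga := (gE a).1 => /ga degE; rewrite mdegD -degE.
  by case: ifP => // _; rewrite big1.
have p0 : toric_map (\sum_a v 0 a * g a - q) = 0.
  by rewrite raddfB /= -augE -vE xE subrr.
apply/eqP; rewrite -subr_eq0 xE /= -raddfB -(toric_map_filter0 d p0) /=; apply/eqP.
congr toric_map; apply/mpolyP => m; rewrite mcoeffB !mcoeff_filter mcoeffB.
case: eqP => // md; rewrite (dhomog_nemf_coeff qd) ?subr0 //; exact/eqP.
Qed.

End Toric.

(** * The class of a disjoint union of complete bipartite graphs *)

Section GridSubgraph.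
Variables (k : fieldType) (G : sgraph) (T : finType) (m n : T -> nat).
Variables (rv cv : T -> nat -> G).
Hypotheses (m_gt0 : forall t, (0 < m t)%N) (n_gt0 : forall t, (0 < n t)%N).
Hypothesis m_le_n : forall t, (m t <= n t)%N.
Hypothesis rv_inj : forall t i t' i', (i < m t)%N -> (i' < m t')%N ->
  rv t i = rv t' i' -> t = t' /\ i = i'.
Hypothesis cv_inj : forall t j t' j', (j < n t)%N -> (j' < n t')%N ->
  cv t j = cv t' j' -> t = t' /\ j = j'.
Hypothesis rv_neq_cv : forall t i t' j, (i < m t)%N -> (j < n t')%N ->
  rv t i != cv t' j.
Hypothesis rv_cv_edge : forall t i j, (i < m t)%N -> (j < n t)%N ->
  [set rv t i; cv t j] \in edges G.
(** This encodes inducedness: an edge that is not a cell has an end off the subgraph, where [alpha]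
    vanishes. *)
Hypothesis edge_cases : forall E, E \in edges G ->
  (exists t i j, [/\ (i < m t)%N, (j < n t)%N & E = [set rv t i; cv t j]]) \/
  exists2 v, v \in E & forall t,
    (forall i, (i < m t)%N -> v != rv t i) /\ (forall j, (j < n t)%N -> v != cv t j).

Local Notation N := #|edges G|.
Implicit Types (e : 'I_N) (F H : {set 'I_N}).

Definition cell t i j : 'I_N :=
  enum_rank_in (rv_cv_edge (m_gt0 t) (n_gt0 t)) [set rv t i; cv t j].

Lemma enum_val_cell t i j : (i < m t)%N -> (j < n t)%N ->
  enum_val (cell t i j) = [set rv t i; cv t j].
Proof. by move=> im jn; rewrite enum_rankK_in // rv_cv_edge. Qed.

Lemma cell_inj t i j t' i' j' : (i < m t)%N -> (j < n t)%N ->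
  (i' < m t')%N -> (j' < n t')%N -> cell t i j = cell t' i' j' ->
  [/\ t = t', i = i' & j = j'].
Proof.
move=> im jn im' jn' /(congr1 enum_val); rewrite !enum_val_cell // => eE.
have : rv t i \in [set rv t' i'; cv t' j'] by rewrite -eE set21.
rewrite !inE (negPf (rv_neq_cv im jn')) orbF => /eqP/(rv_inj im im')[tt' ->].
have : cv t j \in [set rv t' i'; cv t' j'] by rewrite -eE set22.
rewrite !inE eq_sym (negPf (rv_neq_cv im' jn)) /= => /eqP/(cv_inj jn jn')[_ ->].
by [].
Qed.

Local Notation V x := (U_(enum_rank x) : 'X_{1..#|G|})%MM.
Local Notation Rows := (rows m).
Local Notation row := (grid_row m n cell).

Lemma edge_mnm_cell t i j : (i < m t)%N -> (j < n t)%N ->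
  edge_mnm (cell t i j) = (V (rv t i) + V (cv t j))%MM.
Proof.
move=> im jn; rewrite -edge_mnmE enum_val_cell // big_setU1 ?big_set1 //.
by rewrite inE rv_neq_cv.
Qed.

(** On the support of [z] each row misses one cell; the first-row edge in the same column supplies
    the missing column vertex. Thus the product with the face has the same multidegree for every
    such [F]. *)
Definition cofactor_mnm F : 'X_{1..N} :=
  (\sum_(r <- Rows) \sum_(j < n r.1 | cell r.1 r.2 j \notin F) U_(cell r.1 0 j))%MM.

Definition face_mnm F : 'X_{1..#|G|} := (\sum_(e in F) edge_mnm e)%MM.

(** Each row contributes its [(n r.1).-1] cells and one first-row edge, which together cover every
    column once. *)
Definition alpha : 'X_{1..#|G|} :=
  (\sum_(r <- Rows) (V (rv r.1 0) + V (rv r.1 r.2) *+ (n r.1).-1 +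
    \sum_(j < n r.1) V (cv r.1 j)))%MM.

Local Notation z := (grid_cycle k m n cell).
Local Notation y := (grid_cocycle k m n cell).

Lemma rowsP r : r \in Rows -> (0 < r.2 < m r.1)%N.
Proof. by case: r => t i; rewrite mem_rows. Qed.

Lemma card_row_out t i F : (i < m t)%N ->
  #|[pred j : 'I_(n t) | cell t i j \notin F]| = #|row (t, i) :\: F|.
Proof.
move=> im; have inj : injective (fun j : 'I_(n t) => cell t i j).
  by move=> j j' /(cell_inj im (ltn_ord j) im (ltn_ord j'))[_ _ /val_inj].
rewrite -(card_image inj); apply: eq_card => e; rewrite inE.
apply/imageP/andP => [[j jF ->]|[eF /grid_rowP[j [_ jn] eE]]].
  by split=> //; apply: in_grid_row.
by exists (Ordinal jn); rewrite //= !inE -eE.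
Qed.

Lemma face_mnm_rows F : F \subset \bigcup_(r <- Rows) row r ->
  face_mnm F = (\sum_(r <- Rows) \sum_(j < n r.1 | cell r.1 r.2 j \in F)
    (V (rv r.1 r.2) + V (cv r.1 j)))%MM.
Proof.
move=> FU; rewrite /face_mnm (big_rows (grid_row_disj cell_inj) _ _ (rows_uniq m) FU).
apply: eq_big_seq => -[t i] /rowsP /= /andP[_ im].
pose A := [set j : 'I_(n t) | cell t i j \in F].
transitivity (\sum_(e in [set cell t i j | j : 'I_(n t) in A]) edge_mnm e)%MM.
  apply: eq_bigl => e; apply/andP/imsetP => [[eF /grid_rowP[j [_ jn] eE]]|[j jA ->]].
    by exists (Ordinal jn); rewrite // inE -eE.
  by rewrite inE in jA; rewrite jA in_grid_row.
rewrite big_imset /=; last first.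
  by move=> j j' _ _ /(cell_inj im (ltn_ord j) im (ltn_ord j'))[_ _ /val_inj].
by apply: eq_big => [j|j _]; rewrite ?inE // edge_mnm_cell.
Qed.

Lemma cofactor_face F : z F != 0 ->
  (edge_expo (cofactor_mnm F) + face_mnm F)%MM = alpha.
Proof.
move=> /(grid_cycle_neq0 k cell_inj)[FU B1]; rewrite face_mnm_rows //.
rewrite /cofactor_mnm (big_morph _ (@edge_expoD G) (@edge_expo0 G)).
rewrite -big_split; apply: eq_big_seq => -[t i] /= r_rows.
have /andP[_ im] := rowsP r_rows; simpl in im.
rewrite (big_morph _ (@edge_expoD G) (@edge_expo0 G)).
have out1 : #|[pred j : 'I_(n t) | cell t i j \notin F]| = 1%N.
  by rewrite card_row_out // B1.
have in1 : #|[pred j : 'I_(n t) | cell t i j \in F]| = (n t).-1.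
  rewrite -[in RHS](card_ord (n t)) -(cardC [pred j : 'I_(n t) | cell t i j \notin F]).
  rewrite out1; apply: eq_card => j; by rewrite !inE negbK.
rewrite (eq_bigr (fun j : 'I_(n t) => V (rv t 0) + V (cv t j))%MM); last first.
  by move=> j _; rewrite edge_expoU edge_mnm_cell.
apply/mnmP => v; rewrite !mnmDE mulmnE !mnm_sumE.
under eq_bigr do rewrite mnmDE.
under [X in (_ + X)%N = _]eq_bigr do rewrite mnmDE.
rewrite !big_split /= !sum_nat_const out1 in1 mul1n.
rewrite [X in _ = (_ + X)%N](bigID (fun j : 'I_(n t) => cell t i j \in F)) /=.
rewrite [((n t).-1 * _)%N]mulnC addnACA; congr (_ + _)%N.
exact: addnC.
Qed.

Lemma sum_rows (g : T -> nat) :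
  (\sum_(r <- Rows) g r.1 = \sum_t (m t).-1 * g t)%N.
Proof.
rewrite /rows big_allpairs_dep big_enum; apply: eq_bigr => t _ /=.
by rewrite big_const_seq count_predT size_iota iter_addn_0 mulnC.
Qed.

Lemma card_face F : z F != 0 -> #|F| = (\sum_t (m t).-1 * (n t).-1)%N.
Proof.
move=> /(grid_cycle_neq0 k cell_inj)[FU B1]; rewrite -sum1_card.
rewrite (big_rows (grid_row_disj cell_inj) _ _ (rows_uniq m) FU) /=.
rewrite -(sum_rows (fun t => (n t).-1)); apply: eq_big_seq => -[t i] r_rows.
have /andP[_ im] := rowsP r_rows.
have := cardsID F (row (t, i)); rewrite (card_grid_row cell_inj im) (B1 _ r_rows) /=.
by rewrite addn1 => <-; rewrite sum1_card; apply: eq_card => e; rewrite !inE andbC.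
Qed.

Lemma mdeg_cofactor F : z F != 0 -> mdeg (cofactor_mnm F) = (\sum_t (m t).-1)%N.
Proof.
move=> /(grid_cycle_neq0 k cell_inj)[FU B1]; rewrite mdeg_sum.
transitivity (\sum_(r <- Rows) 1)%N; last first.
  by rewrite (sum_rows (fun=> 1%N)); apply: eq_bigr => t _; rewrite muln1.
apply: eq_big_seq => -[t i] r_rows; have /andP[_ im] := rowsP r_rows.
rewrite mdeg_sum /= (eq_bigr (fun=> 1%N)) => [|j _]; last exact: mdeg1.
by rewrite sum1_card card_row_out // B1.
Qed.

Lemma alphaE w : alpha (enum_rank w) = (\sum_(r <- Rows)
  ((rv r.1 0 == w) + (rv r.1 r.2 == w) * (n r.1).-1 + \sum_(j < n r.1) (cv r.1 j == w)))%N.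
Proof.
rewrite mnm_sumE; apply: eq_bigr => r _.
rewrite !mnmDE mulmnE mnm_sumE !mnm1E !(inj_eq enum_rank_inj); congr addn.
by apply: eq_bigr => j _; rewrite mnm1E (inj_eq enum_rank_inj).
Qed.

Lemma sum_rows_eq t : (\sum_(r <- Rows) (r.1 == t) = (m t).-1)%N.
Proof.
rewrite (sum_rows (fun t' => t' == t : nat)) (bigD1 t) //= eqxx muln1 big1 ?addn0 //.
by move=> t' /negPf ->; rewrite muln0.
Qed.

Lemma rv_eq t i t' i' : (i < m t)%N -> (i' < m t')%N ->
  (rv t i == rv t' i') = ((t, i) == (t', i')).
Proof.
by move=> im im'; apply/eqP/eqP => [/(rv_inj im im')[-> ->]|[-> ->]].
Qed.

Lemma alpha_rv0 t : alpha (enum_rank (rv t 0)) = (m t).-1.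
Proof.
rewrite alphaE -sum_rows_eq; apply: eq_big_seq => -[t' i] /rowsP /= /andP[i0 im].
rewrite !rv_eq // !xpair_eqE eqxx andbT (gtn_eqF i0) andbF mul0n addn0.
rewrite big1 ?addn0 // => j _.
by rewrite eq_sym (negPf (rv_neq_cv (m_gt0 t) (ltn_ord j))).
Qed.

Lemma alpha_rv t i : (0 < i < m t)%N -> alpha (enum_rank (rv t i)) = (n t).-1.
Proof.
move=> i_rows; have /andP[i0 im] := i_rows; rewrite -(mem_rows m_gt0) in i_rows.
rewrite alphaE (bigD1_seq _ i_rows (rows_uniq m)) /= eqxx mul1n rv_eq // xpair_eqE.
rewrite (ltn_eqF i0) andbF add0n.
rewrite big1 ?addn0 => [|j _]; last first.
  by rewrite eq_sym (negPf (rv_neq_cv im (ltn_ord j))).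
rewrite big_seq_cond big1 ?addn0 // => -[t' i'] /andP[/rowsP/andP[/= i'0 im'] ne].
rewrite !rv_eq // (negPf ne) mul0n addn0 xpair_eqE (ltn_eqF i0) andbF add0n.
by rewrite big1 // => j _; rewrite eq_sym (negPf (rv_neq_cv im (ltn_ord j))).
Qed.

Lemma alpha_cv t j : (j < n t)%N -> alpha (enum_rank (cv t j)) = (m t).-1.
Proof.
move=> jn; rewrite alphaE -sum_rows_eq.
apply: eq_big_seq => -[t' i] /rowsP /= /andP[i0 im].
rewrite !(negPf (rv_neq_cv _ jn)) // mul0n !add0n.
have [e|t't] := eqVneq t' t.
  rewrite e (bigD1 (Ordinal jn)) //= eqxx big1 // => j' j'j.
  apply/eqP; rewrite eqb0; apply: contraNneq j'j => /(cv_inj (ltn_ord j') jn)[_ jE].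
  exact/eqP/val_inj.
rewrite big1 // => j' _; apply/eqP; rewrite eqb0.
by apply: contraNneq t't => /(cv_inj (ltn_ord j') jn)[tE _]; apply/eqP.
Qed.

Lemma alpha_out w : (forall t, (forall i, (i < m t)%N -> w != rv t i) /\
  (forall j, (j < n t)%N -> w != cv t j)) -> alpha (enum_rank w) = 0%N.
Proof.
move=> out; rewrite alphaE big_seq big1 // => -[t i] /rowsP /= /andP[i0 im].
have [ri cj] := out t; rewrite ![_ == w]eq_sym !(negPf (ri _ _)) // mul0n !add0n.
by rewrite big1 // => j _; rewrite eq_sym (negPf (cj _ _)).
Qed.

Lemma face_ge w (B F : {set 'I_N}) : B \subset F ->
  {in B, forall e, w \in enum_val e} -> (#|B| <= face_mnm F (enum_rank w))%N.
Proof.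
move=> /subsetP BF wB; rewrite mnm_sumE -sum1_card.
rewrite [leqLHS]big_mkcond [leqRHS]big_mkcond leq_sum // => e _.
case: ifP => // eB; by rewrite BF // mnmE enum_rankK wB.
Qed.

(** If [F] contains an edge leaving the subgraph, a full row or a full column, then one vertex
    occurs in [F] more often than [alpha] allows. *)
Lemma face_not_le F : unsupported m n cell (non_cells m n cell) (enum T) (~: F) ->
  ~~ (face_mnm F <= alpha)%MM.
Proof.
move=> uns; suff [w lt] : exists w, (alpha (enum_rank w) < face_mnm F (enum_rank w))%N.
  by apply/mnm_lepP => /(_ (enum_rank w)); rewrite leqNgt lt.
case: uns => [[e ne eF]|[t _ [[i im miss]|[j jn miss]]]].
- have {}eF : e \in F by rewrite inE negbK in eF.
  case: (edge_cases (enum_valP e)) => [[t [i [j [im jn eE]]]]|[w we out]].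
    move/in_non_cells: ne => /(_ t i j im jn)/negP[].
    by apply/eqP/enum_val_inj; rewrite enum_val_cell.
  exists w; rewrite alpha_out // -(cards1 e); apply: face_ge; first by rewrite sub1set.
  by move=> e'; rewrite inE => /eqP ->.
- exists (rv t i); apply: (@leq_trans (n t)).
    (* For row 0 the bound is [(m t).-1], which is below [n t] because [m t <= n t]. *)
    have [i0|i0] := posnP i; last by rewrite alpha_rv ?i0 // prednK.
    by rewrite i0 alpha_rv0 prednK.
  rewrite -(card_grid_row cell_inj im); apply: face_ge.
    apply/subsetP => e /grid_rowP[j [_ jn] ->].
    by have := miss j jn; rewrite inE negbK.
  by move=> e /grid_rowP[j [_ jn] ->]; rewrite enum_val_cell // set21.
- exists (cv t j); rewrite alpha_cv // prednK //.
  have inj : injective (fun i : 'I_(m t) => cell t i j).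
    by move=> i i' /(cell_inj (ltn_ord i) jn (ltn_ord i') jn)[_ /val_inj].
  rewrite -[X in (X <= _)%N](card_ord (m t)) -(card_imset _ inj); apply: face_ge.
    apply/subsetP => e /imsetP[i _ ->].
    by have := miss i (ltn_ord i); rewrite inE negbK.
  by move=> e /imsetP[i _ ->]; rewrite enum_val_cell // set22.
Qed.

Definition koszul_class F : toric_ring k G :=
  to_toric ((z F : k) *: 'X_[cofactor_mnm F]).

(** The component of a Koszul chain in multidegree [alpha], as a scalar chain. Multiplying by the
    face monomial replaces a division of [alpha] and gives 0 when the face does not fit; it turns
    the Koszul differential into the simplicial boundary. *)
Definition alpha_coeff (x : {set 'I_N} -> toric_ring k G) F : k^o :=
  (toric_val (x F) * 'X_[face_mnm F])@_alpha.

Local Notation koszul := (contract (fun e => 'X_e : edge_ring k G)).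

Lemma toric_val_koszul (x : {set 'I_N} -> toric_ring k G) F :
  toric_val (koszul x F) * 'X_[face_mnm F] =
  \sum_(e | e \notin F)
    sgn k e F *: (toric_val (x (e |: F)) * 'X_[face_mnm (e |: F)]).
Proof.
rewrite toric_val_sum mulr_suml; apply: eq_bigr => e eF.
rewrite toric_valZ sgn_mpolyC mulrC [_ * _%:MP]mulrC mul_mpolyC toric_mapZ toric_mapXU.
rewrite {2}/face_mnm big_setU1 //= -/(face_mnm F) mpolyXD -!scalerAl -scalerAr.
congr (_ *: _); by rewrite mulrCA mulrA mulrC.
Qed.

Lemma alpha_coeff_koszul x F :
  alpha_coeff (koszul x) F = contract (fun=> 1) (alpha_coeff x) F.
Proof.
rewrite /alpha_coeff toric_val_koszul raddf_sum; apply: eq_bigr => e _.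
by rewrite /= mcoeffZ mul1r.
Qed.

Lemma toric_val_class F :
  toric_val (koszul_class F) * 'X_[face_mnm F] = (z F : k) *: 'X_[alpha].
Proof.
have [zF|zF] := eqVneq (z F) 0.
  by rewrite /= zF !scale0r raddf0 mul0r.
by rewrite /= toric_mapZ toric_mapX -scalerAl -mpolyXD cofactor_face.
Qed.

Lemma alpha_coeff_class F : alpha_coeff koszul_class F = z F.
Proof. by rewrite /alpha_coeff toric_val_class mcoeffZ mcoeffX eqxx mulr1. Qed.

(** Multiplied by the face monomials, all coefficients become scalars times ['X_[alpha]], and the
    claim reduces to the row cycle having zero boundary. *)
Lemma koszul_class_cycle F : koszul koszul_class F = 0.
Proof.
apply: val_inj => /=; apply: (mulIf (x := 'X_[face_mnm F])).
  by apply/eqP => /(congr1 (mcoeff (face_mnm F)))/eqP; rewrite mcoeffX eqxx mcoeff0 oner_eq0.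
rewrite mul0r toric_val_koszul.
under eq_bigr do rewrite toric_val_class scalerA.
rewrite -scaler_suml (_ : \sum_(e | _) _ = contract (fun=> 1) z F); last first.
  by apply: eq_bigr => e _; rewrite mul1r.
by rewrite (contract_row_cycle k (grid_row_disj cell_inj) F (rows_uniq m))
  scale0r.
Qed.

Lemma alpha_coeff_unsupported x F :
    unsupported m n cell (non_cells m n cell) (enum T) (~: F) ->
  alpha_coeff x F = 0.
Proof.
move=> /face_not_le nle; rewrite /alpha_coeff mcoeffM big1 // => -[m1 m2] /= /eqP aE.
rewrite mcoeffX; case: eqVneq => [e|_]; last by rewrite mulr0.
by rewrite aE e lem_addl in nle.
Qed.

(** If it were a boundary, adjointness would move the contraction onto the cocycle; that contraction
    is nonzero only where [alpha_coeff x] vanishes, so the pairing would be 0. *)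
Lemma koszul_class_not_boundary x : ~ (forall F, koszul_class F = koszul x F).
Proof.
move=> bd; have /negP := grid_pairing_neq0 k m_gt0 n_gt0 cell_inj; apply.
have zE F : z F = contract (fun=> 1) (alpha_coeff x) F.
  rewrite -alpha_coeff_koszul -alpha_coeff_class /alpha_coeff.
  by rewrite bd.
under eq_bigr do rewrite zE.
rewrite contract_adjoint big1 // => F _.
have [->|nz] := eqVneq (contract (fun=> 1) y (~: F)) 0; first by rewrite mulr0 mul0r.
rewrite alpha_coeff_unsupported ?mulr0 //.
apply: (contract_stairs_product m_gt0 n_gt0 cell_inj (@cell_notin_non_cells _ _ m n cell)
  (enum_uniq T) nz).
Qed.

Theorem grid_generator (K : free_complex (toric_ring k G)) :
    minimal_graded_free_resolution (@toric_degree k G) K ->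
  exists a : 'I_(rk K (\sum_t (m t).-1 * (n t).-1)%N),
    shift K a = (\sum_t (m t).-1 * (n t).-1 + \sum_t (m t).-1)%N.
Proof.
move=> K_res; set p := (\sum_t _ * _)%N; set q := (\sum_t (m t).-1)%N.
apply: boolp.contrapT => no_gen.
have {}no_gen (a : 'I_(rk K p)) : shift K a != (p + q)%N.
  by apply/eqP => aE; apply: no_gen; exists a.
(* Off the support of [z] the lift is chosen to be 0, so that the lifts form a chain of exterior
   degree exactly [p]. *)
have /boolp.choice[w wE] F : exists v, aug_map K v = koszul_class F /\
    forall a mu, mu \in msupp (v 0 a) ->
      #|F| = p /\ (mdeg mu + shift K a + p = p + q)%N.
  have [zF|zF] := eqVneq (z F) 0.
    exists 0; split=> [|a mu]; last by rewrite mxE msupp0.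
    rewrite raddf0; apply: val_inj; by rewrite /= zF scale0r raddf0.
  have [|v vE v_deg] := @toric_lift k G K q (koszul_class F) K_res.
    exists ((z F : k) *: 'X_[cofactor_mnm F]) => //.
    by apply: dhomogZ; rewrite dhomogX /= mdeg_cofactor.
  exists v; split=> // a mu /v_deg degE; split; first exact: card_face.
  by rewrite degE addnC.
have hw : homog_chain (p + q) p w by move=> F a mu; apply: (wE F).2.
have augE F : aug_map K (koszul w F) = koszul koszul_class F.
  transitivity (koszul (fun B => aug_map K (w B)) F); first exact: contract_linear.
  by apply: eq_contract => B; apply: (wE B).1.
have [F|u uE] := koszul_cycle_boundary K_res no_gen hw.
  by rewrite augE koszul_class_cycle.
by apply: (@koszul_class_not_boundary u) => F; rewrite -uE (wE F).1.
Qed.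

End GridSubgraph.

(** * From the induced subgraph to the Betti number bounds *)

Lemma biclique_vertices (G : sgraph) (s : nat) (m n : 'I_s -> nat) (W : {set G})
    (m_gt0 : forall i, (0 < m i)%N) (n_gt0 : forall i, (0 < n i)%N) :
    graph_iso (induced_subgraph W)
      (disjoint_union (fun i : 'I_s => complete_bipartite (m i) (n i))) ->
  exists lft rgt : 'I_s -> nat -> G,
  [/\ forall t i t' i', (i < m t)%N -> (i' < m t')%N ->
        lft t i = lft t' i' -> t = t' /\ i = i',
      forall t j t' j', (j < n t)%N -> (j' < n t')%N ->
        rgt t j = rgt t' j' -> t = t' /\ j = j',
      forall t i t' j, (i < m t)%N -> (j < n t')%N -> lft t i != rgt t' j,
      forall t i j, (i < m t)%N -> (j < n t)%N -> [set lft t i; rgt t j] \in edges G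
    & forall E, E \in edges G ->
      (exists t i j, [/\ (i < m t)%N, (j < n t)%N & E = [set lft t i; rgt t j]]) \/
      exists2 v, v \in E & forall t, (forall i, (i < m t)%N -> v != lft t i) /\
        (forall j, (j < n t)%N -> v != rgt t j)].
Proof.
case=> f [g fK gK] f_adj.
pose D := disjoint_union (fun i : 'I_s => complete_bipartite (m i) (n i)).
pose nu (p : D) : G := val (g p).
have nu_inj : injective nu by move=> p q /val_inj/(can_inj gK).
have nu_adj p q : adj (nu p) (nu q) = adj p q by rewrite -[p in RHS]gK -[q in RHS]gK f_adj.
(* Labels in a nondependent type let equalities of vertices be inverted without transporting along
   equal tags. *)
pose label (p : D) := (tag p, match tagged p with
  | inl i => (true, val i) | inr j => (false, val j) end).
(* An index out of range defaults to 0, which exists because both sides are nonempty. *)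
pose L t i : D := Tagged (fun t => complete_bipartite (m t) (n t))
  (inl (insubd (Ordinal (m_gt0 t)) i)).
pose R t j : D := Tagged (fun t => complete_bipartite (m t) (n t))
  (inr (insubd (Ordinal (n_gt0 t)) j)).
have labelL t i : (i < m t)%N -> label (L t i) = (t, (true, i)).
  by move=> im; rewrite /label /= val_insubd im.
have labelR t j : (j < n t)%N -> label (R t j) = (t, (false, j)).
  by move=> jn; rewrite /label /= val_insubd jn.
exists (fun t i => nu (L t i)), (fun t j => nu (R t j)); split.
- move=> t i t' i' im im' /nu_inj/(congr1 label).
  by rewrite !labelL // => -[-> ->].
- move=> t j t' j' jn jn' /nu_inj/(congr1 label).
  by rewrite !labelR // => -[-> ->].
- move=> t i t' j im jn; apply/eqP => /nu_inj/(congr1 label).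
  by rewrite labelL // labelR.
- move=> t i j im jn; apply/imsetP; exists (nu (L t i), nu (R t j)) => //.
  by rewrite inE /= nu_adj /= /dunion_adj /= eqxx tagged_asE.
move=> E /imsetP[[x y]]; rewrite inE /= => xy ->{E}.
have outW v : v \notin W -> forall t,
    (forall i, (i < m t)%N -> v != nu (L t i)) /\
    (forall j, (j < n t)%N -> v != nu (R t j)).
  by move=> vW t; split=> a _; apply: contraNneq vW => ->; apply: valP.
have [xW|xW] := boolP (x \in W); last first.
  by right; exists x; [rewrite set21 | exact: outW].
have [yW|yW] := boolP (y \in W); last first.
  by right; exists y; [rewrite set22 | exact: outW].
left; have xE : x = nu (f (Sub x xW)) by rewrite /nu fK SubK.
have yE : y = nu (f (Sub y yW)) by rewrite /nu fK SubK.
move: xy; rewrite xE yE nu_adj /= /dunion_adj.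
case: (f (Sub x xW)) (f (Sub y yW)) => [t a] [t' b] /= /andP[/eqP tt'].
subst t'; rewrite tagged_asE.
have LE (i : 'I_(m t)) :
    nu (Tagged (fun t => complete_bipartite (m t) (n t)) (inl i)) = nu (L t i).
  have iE : insubd (Ordinal (m_gt0 t)) i = i.
    by apply: val_inj; rewrite val_insubd ltn_ord.
  by rewrite /L iE.
have RE (j : 'I_(n t)) :
    nu (Tagged (fun t => complete_bipartite (m t) (n t)) (inr j)) = nu (R t j).
  have jE : insubd (Ordinal (n_gt0 t)) j = j.
    by apply: val_inj; rewrite val_insubd ltn_ord.
  by rewrite /R jE.
case: a b => [i|j] [i'|j'] //= _.
  by exists t, i, j'; split; rewrite // -LE -RE.
by exists t, i', j; split; rewrite // -LE -RE setUC.
Qed.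

(** In each biclique the smaller side is taken as the rows, as [grid_generator] requires. *)
Lemma biclique_generator (k : fieldType) (G : sgraph) (s : nat) (m n : 'I_s -> nat)
    (W : {set G}) (K : free_complex (toric_ring k G))
    (m_gt0 : forall i, (0 < m i)%N) (n_gt0 : forall i, (0 < n i)%N) :
    graph_iso (induced_subgraph W)
      (disjoint_union (fun i : 'I_s => complete_bipartite (m i) (n i))) ->
    minimal_graded_free_resolution (@toric_degree k G) K ->
  exists a : 'I_(rk K (\sum_(i < s) (m i - 1) * (n i - 1))%N),
    shift K a = (\sum_(i < s) (m i - 1) * (n i - 1) +
      \sum_(i < s) (minn (m i) (n i) - 1))%N.
Proof.
move=> /(biclique_vertices m_gt0 n_gt0)[lft [rgt [linj rinj lr lr_edge cases]]] K_res.
pose m' t := minn (m t) (n t); pose n' t := maxn (m t) (n t).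
pose rv t := if (m t <= n t)%N then lft t else rgt t.
pose cv t := if (m t <= n t)%N then rgt t else lft t.
have m'_gt0 t : (0 < m' t)%N by rewrite leq_min m_gt0 n_gt0.
have n'_gt0 t : (0 < n' t)%N by rewrite leq_max m_gt0.
have m'_le t : (m' t <= n' t)%N by rewrite geq_min leq_maxl.
have shapeP t :
    [/\ (m t <= n t)%N, m' t = m t, n' t = n t, rv t = lft t & cv t = rgt t] \/
    [/\ (n t < m t)%N, m' t = n t, n' t = m t, rv t = rgt t & cv t = lft t].
  by rewrite /m' /n' /rv /cv; case: leqP => _; [left|right].
have -> : (\sum_(i < s) (m i - 1) * (n i - 1) = \sum_t (m' t).-1 * (n' t).-1)%N.
  apply: eq_bigr => t _; rewrite !subn1.
  by case: (shapeP t) => -[_ -> -> _ _] //; rewrite mulnC.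
have -> : (\sum_(i < s) (minn (m i) (n i) - 1) = \sum_t (m' t).-1)%N.
  by apply: eq_bigr => t _; rewrite subn1.
apply: (grid_generator (rv := rv) (cv := cv) m'_gt0 n'_gt0 m'_le) => //.
- move=> t i t' i'.
  case: (shapeP t) => -[_ -> _ -> _]; case: (shapeP t') => -[_ -> _ -> _].
  + exact: linj.
  + by move=> im im' e; have := lr _ _ _ _ im im'; rewrite e eqxx.
  + by move=> im im' e; have := lr _ _ _ _ im' im; rewrite e eqxx.
  + exact: rinj.
- move=> t i t' i'.
  case: (shapeP t) => -[_ _ -> _ ->]; case: (shapeP t') => -[_ _ -> _ ->].
  + exact: rinj.
  + by move=> im im' e; have := lr _ _ _ _ im' im; rewrite e eqxx.
  + by move=> im im' e; have := lr _ _ _ _ im im'; rewrite e eqxx.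
  + exact: linj.
- move=> t i t' j.
  case: (shapeP t) => -[le -> _ -> _]; case: (shapeP t') => -[le' _ -> _ ->].
  + exact: lr.
  (* Equal vertices would come from the same biclique, but the two bicliques are oriented
     differently. *)
  + move=> im jm; apply/eqP => /(linj _ _ _ _ im jm)[tt' _].
    by rewrite -tt' ltnNge le in le'.
  + move=> im jm; apply/eqP => /(rinj _ _ _ _ im jm)[tt' _].
    by rewrite -tt' leqNgt le in le'.
  + by move=> im jm; rewrite eq_sym; apply: lr.
- move=> t i j; case: (shapeP t) => -[_ -> -> -> ->] im jn; first exact: lr_edge.
  by rewrite setUC; apply: lr_edge.
- move=> E /cases[[t [i [j [im jn ->]]]]|[v vE out]]; [left|right].
    case: (shapeP t) => -[_ mE nE rE cE].
      by exists t, i, j; rewrite mE nE rE cE.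
    by exists t, j, i; rewrite mE nE rE cE setUC.
  exists v => // t; have [outl outr] := out t.
  by case: (shapeP t) => -[_ -> -> -> ->].
Qed.

Theorem theorem3p9 (k : fieldType) (G : sgraph) (s : nat) (m n : 'I_s -> nat)
    (W : {set G})
    (m_gt0 : forall i, (0 < m i)%N) (n_gt0 : forall i, (0 < n i)%N)
    (W_iso : graph_iso (induced_subgraph W)
               (disjoint_union (fun i : 'I_s => complete_bipartite (m i) (n i)))) :
  (forall r : int, is_regularity (@toric_degree k G) r ->
     (\sum_(i < s) minn (m i) (n i))%N%:Z - s%:Z <= r) /\
  (forall p : nat, is_projdim (@toric_degree k G) p ->
     (\sum_(i < s) (m i - 1) * (n i - 1) <= p)%N).
Proof.
have nonzero beta : betti_numbers (@toric_degree k G) beta ->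
    let p := (\sum_(i < s) (m i - 1) * (n i - 1))%N in
    beta p (p + \sum_(i < s) (minn (m i) (n i) - 1))%N <> 0%N.
  move=> [K K_res betaE] p; have [a aE] := biclique_generator m_gt0 n_gt0 W_iso K_res.
  rewrite betaE => /eqP; rewrite cards_eq0 => /eqP/setP/(_ a).
  by rewrite !inE aE eqxx.
split=> [r [beta /nonzero nz [_ bound]]|p [beta /nonzero nz [_ bound]]]; last first.
  exact: bound nz.
(* The generator has [j - i] equal to the sum of the [minn (m t) (n t) - 1]; each minimum is
   positive, so the truncated subtractions lose nothing. *)
apply: le_trans (bound _ _ nz); rewrite PoszD addrAC subrr add0r.
rewrite lerBlDr -PoszD lez_nat.
apply: (@leq_trans (\sum_(t < s) (minn (m t) (n t) - 1) + \sum_(t < s) 1)%N);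
  last by rewrite sum1_card card_ord.
rewrite -big_split leq_sum // => t _.
by rewrite /= subnK // leq_min m_gt0 n_gt0.
Qed.
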